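(* Let $n$ and $k$ be positive integers and let $a\in\mathbb{C}$, $a\neq 0$. Consider the planar differential equation, written in the complex coordinate $z=x+iy$, \[ \dot z = iz + a\,(z\overline{z})^n z^{k+1}. \] The origin is a center of this equation, and its period function is monotonous decreasing. Moreover, the period function tends to $2\pi$ as the periodic orbits approach the origin, and tends to $\dfrac{2(k+n)\pi}{k+2n}$ as the periodic orbits approach the boundary of the period annulus.
   Context: The period annulus of a center is the largest punctured neighborhood of the center foliated by periodic orbits. The period function assigns to each periodic orbit in the period annulus its minimal period; it is considered as a function of a parameter that increases monotonically from the center to the outer boundary of the period annulus (e.g. the distance from the center of the intersection point of the orbit with a transversal ray emanating from the center). ''Monotonous decreasing'' refers to this parametrization. *)

(* Defs.v *)
From Stdlib Require Import Reals.
From Coquelicot Require Import Coquelicot.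
Open Scope R_scope.

Definition cadd (z w : R * R) : R * R := (fst z + fst w, snd z + snd w).
Definition cmul (z w : R * R) : R * R :=
  (fst z * fst w - snd z * snd w, fst z * snd w + snd z * fst w).
Fixpoint cpow (z : R * R) (m : nat) : R * R :=
  match m with O => (1, 0) | S m' => cmul z (cpow z m') end.
Definition cscal (c : R) (z : R * R) : R * R := (c * fst z, c * snd z).
Definition znorm2 (z : R * R) : R := fst z * fst z + snd z * snd z.
Definition ci : R * R := (0, 1).

Definition field (a : R * R) (n k : nat) (z : R * R) : R * R :=
  cadd (cmul ci z) (cmul a (cscal (znorm2 z ^ n) (cpow z (k + 1)))).

Definition origin : R * R := (0, 0).

Definition is_solution (F : R * R -> R * R) (f : R -> R * R) : Prop :=
  forall t : R, is_derive f t (F (f t)).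

Definition minimal_period (F : R * R -> R * R) (p : R * R) (T : R) : Prop :=
  exists f : R -> R * R,
    is_solution F f /\ f 0 = p /\ 0 < T /\
    (forall t, f (t + T) = f t) /\
    (forall s, 0 < s < T -> f s <> p).

Definition periodic_point (F : R * R -> R * R) (p : R * R) : Prop :=
  exists T, minimal_period F p T.

Definition is_center (F : R * R -> R * R) : Prop :=
  F origin = origin /\
  exists r, 0 < r /\
    forall p, 0 < znorm2 p < r * r -> periodic_point F p.

Definition path_connected (Q : R * R -> Prop) : Prop :=
  forall x y, Q x -> Q y ->
    exists g : R -> R * R,
      (forall t, continuous g t) /\ g 0 = x /\ g 1 = y /\
      (forall t, 0 <= t <= 1 -> Q (g t)).

(* Period annulus (together with the center): the largest open connected
   neighbourhood of the origin whose points other than the origin all lie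
   on periodic orbits, i.e. the union of all such sets. *)
Definition period_annulus (F : R * R -> R * R) (x : R * R) : Prop :=
  x <> origin /\
  exists Q : R * R -> Prop,
    open Q /\ path_connected Q /\ Q origin /\
    (forall p, Q p -> p <> origin -> periodic_point F p) /\ Q x.

Definition ray_point (u : R * R) (s : R) : R * R := cscal s u.

(* Parameters s such that the whole ray segment ]0, s] lies in the
   period annulus: the transversal section parametrized by distance. *)
Definition ray_section (F : R * R -> R * R) (u : R * R) (s : R) : Prop :=
  0 < s /\ forall s', 0 < s' <= s -> period_annulus F (ray_point u s').

Definition transversal_ray (F : R * R -> R * R) (u : R * R) : Prop :=
  forall s, ray_section F u s ->
    fst u * snd (F (ray_point u s)) - snd u * fst (F (ray_point u s)) <> 0.

(* Main.v *)
Require Import Defs.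
From Stdlib Require Import Reals Lra Lia Psatz Ranalysis5 ClassicalEpsilon.
From Coquelicot Require Import Coquelicot.
Open Scope R_scope.

(* Write [m = 2n+k], [c = k/(2(n+k)) < 1/2], [a |z|^(2n) z^k = xi + i eta] and [psi = k theta + phi]
   for its argument.  Then [r' = r xi], [theta' = 1 + eta], and [(c + eta)' = 2(n+k) xi (c + eta)],
   so [c + eta] is up to a constant a first integral times [|z|^(2(n+k))].  On [eta = -c] the equation
   reduces to [xi' = m xi^2 + k c (1 - c)], which blows up; hence the period annulus is
   [{c + eta > 0}] minus the origin.  There the orbits are [r = mu W(h sin psi)] with
   [h = alpha mu^m], [alpha = |a|], where [w = W(x)] solves [w^k - c/w^m = x], and the period is
   [T(h)], the integral over [0, 2 pi] of [E(h sin psi)], with [E = 1/(w^(2(n+k)) + 1 - c)].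

   For [K = w^k E] one has [K' = (1 - c) x E'], and an integration by parts turns
   [(1 - c) h^2 T'(h)] into the integral of [sin psi P(h sin psi)] with [P = (x K)'].
   Setting [t = 1 - E] and [kappa = c/(1 - c)], [P = K (1 - t^2/kappa)] and
   [x P'/P = - (t^2/c) (3(1 - c) + 2(1 - 2c) t/(kappa - t^2))];
   since [t(x) > -t(-x)] for [x > 0], comparing logarithmic derivatives gives [P(x) < P(-x)],
   so [T' < 0].  The limits follow from [E(0) = 1] and [E(x) + E(-x) -> 1/(1 - c)]. *)

(** For [n = 0] one would have [c = 1/2] and [t (- x) = - t x]: the two half turns would compensate
    exactly and the period would be constant. So the sign of [T'] can only come from the difference
    between [x] and [- x], and it must draw on [c < 1/2]. Pairing [psi] with [psi + PI] directly in
    [T'] is not enough. The sum [E x + E (- x)] starts at 2, sinks below [1/(1 - c)] and returns to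
    it from below, because [1/(1 - c) - E (- x)] decays like [x^(-2(n+k)/m)], more slowly than
    [E x]. The folded integrand of [T'] therefore changes sign for large [h]. The integration by
    parts trades [E'] for [P], whose folded integrand has a single sign. The inequality
    [t x > - t (- x)] is algebraic: [1 / t x] and [- 1 / t (- x)] are tied by one polynomial
    equation, obtained by eliminating [w]. *)

(** * Increasing functions and their inverses *)

Lemma incr_lt (f f' : R -> R) :
  (forall x, is_derive f x (f' x)) -> (forall x, 0 < f' x) ->
  forall x y, x < y -> f x < f y.
Proof.
  intros Hf Hp x y Hxy.
  apply (incr_function f m_infty p_infty f'); simpl; auto.
  intros; apply Hp.
Qed.

Lemma is_derive_continuous_R (f : R -> R) (x l : R) : is_derive f x l -> continuous f x.
Proof. intros H; apply (ex_derive_continuous f); exists l; exact H. Qed.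

(** Bracketing every value gives surjectivity through the intermediate value theorem, without limits
    at infinity. The lemma serves twice: to solve for the radial function and to turn time as a
    function of the angle into the angle as a function of time. *)
Lemma inverse_function (f f' : R -> R) :
  (forall x, is_derive f x (f' x)) -> (forall x, 0 < f' x) ->
  (forall y, exists a b, f a <= y <= f b) ->
  exists g : R -> R, (forall y, f (g y) = y) /\ (forall y, is_derive g y (/ f' (g y))).
Proof.
  intros Hf Hp Hs.
  assert (Hc : forall x, continuity_pt f x).
  { intros x. apply continuity_pt_filterlim. apply (is_derive_continuous_R f x (f' x)), Hf. }
  assert (Hi := incr_lt f f' Hf Hp).
  assert (Hex : forall y, exists x, f x = y).
  { intros y. destruct (Hs y) as (a & b & Ha & Hb).
    destruct (IVT_gen f a b y Hc) as (x & _ & Hx).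
    - rewrite Rmin_left, Rmax_right by lra. lra.
    - exists x; exact Hx. }
  set (g := fun y => proj1_sig (constructive_indefinite_description _ (Hex y))).
  assert (Hg : forall y, f (g y) = y).
  { intros y. unfold g. destruct constructive_indefinite_description; auto. }
  exists g. split; [exact Hg|].
  assert (Hgi : forall x y, x < y -> g x < g y).
  { intros x y Hxy. destruct (Rle_lt_dec (g y) (g x)) as [H|H]; auto. exfalso.
    destruct H as [H|H].
    - apply Hi in H. rewrite !Hg in H. lra.
    - apply (f_equal f) in H. rewrite !Hg in H. lra. }
  assert (Hgf : forall x, g (f x) = x).
  { intros x. destruct (Rtotal_order (g (f x)) x) as [H|[H|H]]; auto;
      apply Hi in H; rewrite Hg in H; lra. }
  assert (Hgc : forall y, continuity_pt g y).
  { intros y eps He.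
    assert (H1 : f (g y - eps) < y) by (rewrite <- (Hg y) at 2; apply Hi; lra).
    assert (H2 : y < f (g y + eps)) by (rewrite <- (Hg y) at 1; apply Hi; lra).
    exists (Rmin (y - f (g y - eps)) (f (g y + eps) - y)). split.
    - apply Rmin_glb_lt; lra.
    - intros z [_ Hz]. simpl in *. unfold R_dist in *.
      assert (Hz1 := Rlt_le_trans _ _ _ Hz (Rmin_l _ _)).
      assert (Hz2 := Rlt_le_trans _ _ _ Hz (Rmin_r _ _)).
      apply Rabs_def2 in Hz1. apply Rabs_def2 in Hz2.
      assert (A1 : g (f (g y - eps)) < g z) by (apply Hgi; lra).
      assert (A2 : g z < g (f (g y + eps))) by (apply Hgi; lra).
      rewrite Hgf in A1, A2. apply Rabs_def1; lra. }
  intros y. apply is_derive_Reals.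
  assert (Prf : forall a, g (y - 1) <= a <= g (y + 1) -> derivable_pt f a).
  { intros a _. exists (f' a). apply is_derive_Reals, Hf. }
  assert (Prg : g (y - 1) <= g y <= g (y + 1)).
  { split; apply Rlt_le, Hgi; lra. }
  assert (E : derive_pt f (g y) (Prf (g y) Prg) = f' (g y)).
  { apply derive_pt_eq_0, is_derive_Reals, Hf. }
  replace (/ f' (g y)) with (1 / derive_pt f (g y) (Prf (g y) Prg)).
  - apply (Ranalysis5.derivable_pt_lim_recip_interv f g (y - 1) (y + 1) y Prf); try lra; auto.
    + intros; apply Hg.
    + rewrite E. specialize (Hp (g y)). lra.
  - rewrite E. unfold Rdiv; ring.
Qed.

Lemma pow_strict_incr (j : nat) (u v : R) : 0 <= u < v -> (0 < j)%nat -> u ^ j < v ^ j.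
Proof.
  intros Huv Hj. destruct j as [|j]; [lia|]. clear Hj. induction j as [|j IH]; [simpl; lra|].
  change (u * u ^ S j < v * v ^ S j). assert (0 <= u ^ S j) by (apply pow_le; lra). nra.
Qed.

(** * Means over sine curves *)

Definition mean_sin (E : R -> R) (h : R) : R := RInt (fun psi => E (h * sin psi)) 0 (2 * PI).

Lemma continuous_scal_sin (f : R -> R) (h : R) :
  (forall x, continuous f x) -> forall x, continuous (fun psi => f (h * sin psi)) x.
Proof.
  intros Hf x. apply (continuous_comp (fun psi => h * sin psi) f); [|apply Hf].
  apply (ex_derive_continuous (fun psi => h * sin psi)). auto_derive; auto.
Qed.

Lemma continuous_Rmult (f g : R -> R) x :
  continuous f x -> continuous g x -> continuous (fun y => f y * g y) x.
Proof. apply (continuous_mult f g). Qed.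

(** The second half turn is the first one shifted by [PI], where the sine changes sign. Every
    comparison between the values at [x] and at [- x] enters the integrals through this folding. *)
Lemma RInt_sin_fold (f : R -> R) :
  (forall x, continuous f x) ->
  RInt (fun psi => f (sin psi)) 0 (2 * PI) =
  RInt (fun psi => f (sin psi) + f (- sin psi)) 0 PI.
Proof.
  intros Hf.
  assert (Hc : forall (g : R -> R) a b, (forall x, continuous g x) -> ex_RInt g a b)
    by (intros g a b Hg; apply (ex_RInt_continuous (V := R_CompleteNormedModule)); intros; apply Hg).
  assert (Hs : forall x, continuous (fun psi => f (sin psi)) x)
    by (intros x; apply (continuous_comp sin f); [apply continuous_sin|apply Hf]).
  rewrite <- (RInt_Chasles (fun psi => f (sin psi)) 0 PI (2 * PI)); try (apply Hc, Hs).
  assert (E : RInt (fun psi => f (- sin psi)) 0 PI = RInt (fun psi => f (sin psi)) PI (2 * PI)).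
  { replace PI with (1 * 0 + PI) at 2 by ring. replace (2 * PI) with (1 * PI + PI) by ring.
    rewrite <- (RInt_comp_lin (fun psi => f (sin psi)) 1 PI 0 PI) by (apply Hc, Hs).
    apply RInt_ext. intros x _. change (scal 1 ?u) with (1 * u).
    replace (1 * x + PI) with (x + PI) by ring. rewrite neg_sin. symmetry. apply Rmult_1_l. }
  rewrite <- E. symmetry.
  apply (RInt_plus (fun psi => f (sin psi)) (fun psi => f (- sin psi))); apply Hc; auto.
  intros x. apply (continuous_comp (fun y => - sin y) f); [|apply Hf].
  apply (continuous_opp sin), continuous_sin.
Qed.

Lemma mean_sin_derive (E E1 : R -> R) (h : R) :
  (forall x, is_derive E x (E1 x)) -> (forall x, continuous E1 x) ->
  is_derive (mean_sin E) h (RInt (fun psi => sin psi * E1 (h * sin psi)) 0 (2 * PI)).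
Proof.
  intros HE HE1.
  assert (Hd : forall u psi, is_derive (fun z => E (z * sin psi)) u (sin psi * E1 (u * sin psi))).
  { intros u psi. apply (is_derive_comp E (fun z => z * sin psi)); [apply HE|].
    auto_derive; auto; ring. }
  rewrite <- (RInt_ext (fun psi => Derive (fun u => E (u * sin psi)) h)).
  2: { intros psi _. apply is_derive_unique, Hd. }
  apply (is_derive_RInt_param (fun u psi => E (u * sin psi))).
  - apply filter_forall. intros u psi _. exists (sin psi * E1 (u * sin psi)). apply Hd.
  - intros psi _.
    apply (continuity_2d_pt_ext (fun u v => sin v * E1 (u * sin v))).
    + intros u v. symmetry. apply is_derive_unique, Hd.
    + assert (S2 : continuity_2d_pt (fun _ v => sin v) h psi).
      { apply (continuity_1d_2d_pt_comp sin (fun _ v => v)).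
        - apply continuity_sin.
        - apply continuity_2d_pt_id2. }
      apply continuity_2d_pt_mult; auto.
      apply (continuity_1d_2d_pt_comp E1 (fun u v => u * sin v)).
      * apply continuity_pt_filterlim, HE1.
      * apply continuity_2d_pt_mult; auto. apply continuity_2d_pt_id1.
  - apply filter_forall. intros u. apply (ex_RInt_continuous (V := R_CompleteNormedModule)). intros psi _.
    apply continuous_scal_sin. intros x. apply (is_derive_continuous_R E x (E1 x)), HE.
Qed.

(* Integrating the derivative of [cos psi * K (h sin psi)] over a period gives
   [e h^2 T'(h) = RInt (sin psi * P (h sin psi))] with [P = (x K)'];
   pairing [psi] with [psi + PI] leaves [P x - P (- x)]. *)
Lemma mean_sin_decreasing (E E1 K K1 : R -> R) (e : R) :
  0 < e ->
  (forall x, is_derive E x (E1 x)) -> (forall x, continuous E1 x) ->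
  (forall x, is_derive K x (K1 x)) ->
  (forall x, K1 x = e * (x * E1 x)) ->
  (forall x, 0 < x -> K x + x * K1 x < K (- x) + - x * K1 (- x)) ->
  forall h1 h2, 0 < h1 < h2 -> mean_sin E h2 < mean_sin E h1.
Proof.
  intros He HE HE1 HK HKE HP h1 h2 [Hh1 Hh].
  set (d := fun h => RInt (fun psi => sin psi * E1 (h * sin psi)) 0 (2 * PI)).
  assert (HcK : forall x, continuous K x) by (intros x; apply (is_derive_continuous_R K x (K1 x)), HK).
  assert (HcK1 : forall x, continuous K1 x).
  { intros x. apply (continuous_ext (fun x => e * (x * E1 x))); [intros; symmetry; apply HKE|].
    apply (continuous_Rmult (fun _ => e)); [apply continuous_const|].
    apply (continuous_Rmult (fun y => y)); [apply continuous_id|auto]. }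
  set (P := fun x => K x + x * K1 x).
  assert (HcP : forall x, continuous P x).
  { intros x. apply (continuous_plus K (fun x => x * K1 x)); auto.
    apply (continuous_Rmult (fun y => y)); [apply continuous_id|auto]. }
  assert (Hex : forall (g : R -> R) a b, (forall x, continuous g x) -> ex_RInt g a b)
    by (intros g a b Hg; apply (ex_RInt_continuous (V := R_CompleteNormedModule)); intros; apply Hg).
  assert (Hd : forall h, 0 < h -> d h < 0).
  { intros h Hp.
    assert (Hq : forall x, continuous (fun psi => sin psi * E1 (h * sin psi)) x).
    { intros x. apply continuous_Rmult; [apply continuous_sin|apply continuous_scal_sin; auto]. }
    assert (Hr : forall x, continuous (fun psi => h * K1 (h * sin psi)) x).
    { intros x. apply (continuous_Rmult (fun _ => h)); [apply continuous_const|apply continuous_scal_sin; auto]. }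
    assert (Hs : forall x, continuous (fun psi => sin psi * P (h * sin psi)) x).
    { intros x. apply continuous_Rmult; [apply continuous_sin|apply continuous_scal_sin; auto]. }
    assert (I1 : e * h * h * d h = RInt (fun psi => h * K1 (h * sin psi)) 0 (2 * PI)).
    { unfold d. rewrite <- (RInt_scal (V := R_CompleteNormedModule) _ 0 (2 * PI) (e * h * h)) by (apply Hex, Hq).
      apply RInt_ext. intros x _. rewrite HKE. change (scal ?u ?v) with (u * v). simpl. ring. }
    assert (I2 : is_RInt (fun psi => h * K1 (h * sin psi) - sin psi * P (h * sin psi)) 0 (2 * PI) 0).
    { evar_last.
      - apply (is_RInt_derive (fun psi => cos psi * K (h * sin psi))).
        + intros x _. auto_derive.
          * exists (K1 (h * sin x)). apply HK.
          * change (Derive (fun x0 : R => K x0) (h * sin x)) with (Derive K (h * sin x)).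
            rewrite (is_derive_unique K _ _ (HK (h * sin x))). unfold P.
            assert (S := sin2_cos2 x). unfold Rsqr in S.
            replace (1 * cos x) with (cos x) by ring.
            transitivity (h * (cos x * cos x) * K1 (h * sin x) - sin x * K (h * sin x)); [ring|].
            replace (cos x * cos x) with (1 - sin x * sin x) by lra. ring.
        + intros x _. apply (continuous_minus (fun psi => h * K1 (h * sin psi))); auto.
      - rewrite cos_2PI, sin_2PI, cos_0, sin_0. apply (minus_eq_zero (G := R_AbelianGroup)). }
    assert (I3 : RInt (fun psi => h * K1 (h * sin psi)) 0 (2 * PI) =
                 RInt (fun psi => sin psi * P (h * sin psi)) 0 (2 * PI)).
    { apply (is_RInt_unique (V := R_CompleteNormedModule)) in I2.
      assert (J : RInt (fun psi => h * K1 (h * sin psi) - sin psi * P (h * sin psi)) 0 (2 * PI) =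
                  RInt (fun psi => h * K1 (h * sin psi)) 0 (2 * PI) -
                  RInt (fun psi => sin psi * P (h * sin psi)) 0 (2 * PI)).
      { apply (RInt_minus (V := R_CompleteNormedModule) (fun psi => h * K1 (h * sin psi))); apply Hex; auto. }
      lra. }
    rewrite (RInt_sin_fold (fun s => s * P (h * s))) in I3.
    2: { intros x. apply (continuous_Rmult (fun s => s)); [apply continuous_id|].
         apply (continuous_comp (fun s => h * s) P); auto.
         apply (continuous_Rmult (fun _ => h)); [apply continuous_const|apply continuous_id]. }
    assert (I4 : RInt (fun psi => sin psi * P (h * sin psi) + - sin psi * P (h * - sin psi)) 0 PI < 0).
    { replace 0 with (RInt (fun _ => 0) 0 PI) at 2.
      2: { rewrite RInt_const. apply Rmult_0_r. }
      apply RInt_lt.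
      - apply PI_RGT_0.
      - intros; apply continuous_const.
      - intros x _. apply (continuous_plus (fun psi => sin psi * P (h * sin psi))); auto.
        apply (continuous_Rmult (fun psi => - sin psi)).
        + apply (continuous_opp sin), continuous_sin.
        + apply (continuous_comp (fun s => h * - sin s) P); auto.
          apply (continuous_Rmult (fun _ => h)); [apply continuous_const|apply (continuous_opp sin), continuous_sin].
      - intros x [Hx1 Hx2]. assert (Hsx := sin_gt_0 x Hx1 Hx2).
        assert (Hpx := HP (h * sin x) (Rmult_lt_0_compat _ _ Hp Hsx)).
        unfold P. replace (h * - sin x) with (- (h * sin x)) by ring. nra. }
    rewrite <- I3, <- I1 in I4.
    assert (0 < e * h * h) by (repeat apply Rmult_lt_0_compat; auto).
    nra. }
  assert (J : - mean_sin E h1 < - mean_sin E h2).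
  { apply (incr_function (fun h => - mean_sin E h) 0 p_infty (fun h => - d h)); simpl; auto.
    - intros x _ _. apply (is_derive_opp (mean_sin E)). apply mean_sin_derive; auto.
    - intros x Hx _. specialize (Hd x Hx). lra. }
  lra.
Qed.

(** * Monotonicity of the period integral *)

(* Here [A x] stands for [w^k] and [q x] for [w^(2(n+k))], where [w^k - c/w^(2n+k) = x]. *)
Section Profile.

Variables (c : R) (A q : R -> R).
Hypothesis c_pos : 0 < c.
Hypothesis c_half : c < 1 / 2.
Hypothesis A_pos : forall x, 0 < A x.
Hypothesis q_pos : forall x, 0 < q x.
Hypothesis A_derive : forall x, is_derive A x (q x / (q x + 1 - c)).
Hypothesis q_derive : forall x, is_derive q x (q x * q x / (A x * c * (q x + 1 - c))).
Hypothesis A_q : forall x, A x * (q x - c) = x * q x.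

(** [- kappa] is the lower end of the range of [t], approached as [q] tends to 0. Since [kappa < 1],
    the square of [t] stays below [kappa] on the negative side, whereas on the positive side it may
    exceed [kappa], and there [P] turns negative. *)
Let kappa := c / (1 - c).
Let t x := (q x - c) / (q x + 1 - c).
Let P x := A x / (q x + 1 - c) * (1 - t x * t x / kappa).
Let P1 x := - (q x * t x / (kappa * c * (q x + 1 - c) ^ 2)) *
  (3 * (1 - c) * (kappa - t x * t x) + 2 * (1 - 2 * c) * t x).

Lemma profile_D_pos x : 0 < q x + 1 - c.
Proof. specialize (q_pos x). lra. Qed.

Lemma profile_E_derive x :
  is_derive (fun x => / (q x + 1 - c)) x (- (q x * q x / (A x * c * (q x + 1 - c) ^ 3))).
Proof.
  assert (HD := profile_D_pos x). assert (HA := A_pos x).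
  evar_last.
  - apply (is_derive_inv (fun x => q x + 1 - c) x); [|lra].
    apply (is_derive_minus (fun x => q x + 1) (fun _ => c)); [|apply is_derive_const].
    apply (is_derive_plus q (fun _ => 1)); [apply q_derive|apply is_derive_const].
  - unfold minus, plus, opp, zero; cbn -[pow]. field. lra.
Qed.

Lemma profile_K_derive x :
  is_derive (fun x => A x / (q x + 1 - c)) x
    ((1 - c) * (x * - (q x * q x / (A x * c * (q x + 1 - c) ^ 3)))).
Proof.
  assert (HD := profile_D_pos x). assert (HA := A_pos x). assert (Hq := q_pos x).
  evar_last.
  - apply (is_derive_mult (K := R_AbsRing) A (fun x => / (q x + 1 - c))).
    + apply A_derive.
    + apply profile_E_derive.
    + intros; apply Rmult_comm.
  - unfold plus, mult; cbn -[pow].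
    (* Once [x] is grouped with [q x], the relation [A_q] eliminates it, and a rational identity in
       [A x] and [q x] remains. *)
    replace ((1 - c) * (x * - (q x * q x / (A x * c * (q x + 1 - c) ^ 3))))
      with (- ((1 - c) * (x * q x) * q x / (A x * c * (q x + 1 - c) ^ 3))) by (field; lra).
    rewrite <- A_q.
    field. lra.
Qed.

Lemma profile_t_derive x : is_derive t x (q x * q x / (A x * c * (q x + 1 - c) ^ 3)).
Proof.
  assert (HD := profile_D_pos x). assert (HA := A_pos x).
  apply (is_derive_ext (fun x => 1 - / (q x + 1 - c))).
  { intros y. unfold t. assert (HDy := profile_D_pos y).
    change (1 - / (q y + 1 - c) = (q y - c) / (q y + 1 - c)). field. lra. }
  evar_last.
  - apply (is_derive_minus (fun _ => 1)); [apply is_derive_const|apply profile_E_derive].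
  - unfold minus, plus, opp, zero; cbn -[pow]. field. lra.
Qed.

Lemma profile_t_incr x y : x < y -> t x < t y.
Proof.
  apply (incr_lt t _ profile_t_derive). clear x y. intros x.
  assert (HD := profile_D_pos x). assert (HA := A_pos x). assert (Hq := q_pos x).
  apply Rdiv_lt_0_compat; [nra|]. repeat apply Rmult_lt_0_compat; auto. lra.
Qed.

Lemma profile_t_sign x : 0 < x -> 0 < t x /\ t (- x) < 0.
Proof.
  intros Hx. assert (H0 : t 0 = 0).
  { assert (H := A_q 0). assert (HA := A_pos 0). unfold t.
    replace (q 0 - c) with 0 by nra. unfold Rdiv; ring. }
  rewrite <- H0. split; apply profile_t_incr; lra.
Qed.

Lemma profile_kappa : 0 < kappa < 1.
Proof.
  unfold kappa. split; [apply Rdiv_lt_0_compat; lra|].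
  apply (Rmult_lt_reg_r (1 - c)); [lra|]. unfold Rdiv. rewrite Rmult_assoc, Rinv_l; lra.
Qed.

Lemma profile_t_lower x : - kappa < t x.
Proof.
  assert (HD := profile_D_pos x). assert (Hq := q_pos x).
  replace (t x) with (- kappa + q x / ((1 - c) * (q x + 1 - c))).
  2: { unfold t, kappa. field. lra. }
  assert (0 < q x / ((1 - c) * (q x + 1 - c))); [|lra].
  apply Rdiv_lt_0_compat; auto. apply Rmult_lt_0_compat; lra.
Qed.

(** The left side is [(x K)']. By [x q = A (q - c)] its second summand is [- K t^2 / kappa]. *)
Lemma profile_P_eq x :
  A x / (q x + 1 - c) + x * ((1 - c) * (x * - (q x * q x / (A x * c * (q x + 1 - c) ^ 3)))) = P x.
Proof.
  assert (HD := profile_D_pos x). assert (HA := A_pos x). assert (Hq := q_pos x).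
  unfold P, t, kappa.
  replace (x * ((1 - c) * (x * - (q x * q x / (A x * c * (q x + 1 - c) ^ 3)))))
    with (- ((1 - c) * (x * q x) * (x * q x) / (A x * c * (q x + 1 - c) ^ 3))) by (field; lra).
  rewrite <- A_q.
  field. repeat split; lra.
Qed.

Lemma profile_P_derive x : is_derive P x (P1 x).
Proof.
  assert (HD := profile_D_pos x). assert (HA := A_pos x). assert (Hq := q_pos x).
  evar_last.
  - apply (is_derive_mult (K := R_AbsRing) (fun x => A x / (q x + 1 - c)) (fun x => 1 - t x * t x / kappa)).
    + apply profile_K_derive.
    + apply (is_derive_minus (fun _ => 1)); [apply is_derive_const|].
      apply (is_derive_ext (fun x => / kappa * (t x * t x))); [intros; unfold Rdiv; apply Rmult_comm|].
      apply (is_derive_scal (fun x => t x * t x)).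
      apply (is_derive_mult (K := R_AbsRing) t t); try apply profile_t_derive. intros; apply Rmult_comm.
    + intros; apply Rmult_comm.
  - unfold minus, opp, plus, mult, zero; cbn -[pow]. unfold P1, t, kappa.
    replace ((1 - c) * (x * - (q x * q x / (A x * c * (q x + 1 - c) ^ 3))))
      with (- ((1 - c) * (x * q x) * q x / (A x * c * (q x + 1 - c) ^ 3))) by (field; lra).
    rewrite <- A_q.
    field. repeat split; lra.
Qed.

(** The factor [x] makes the logarithmic derivative a function of [t] alone, because
    [x q = t A (q + 1 - c)]. The values at [x] and [- x] can then be compared through [t]. *)
Lemma profile_P_logderive x :
  kappa - t x * t x <> 0 ->
  x * P1 x = - P x * (t x * t x / c * (3 * (1 - c) + 2 * (1 - 2 * c) * t x / (kappa - t x * t x))).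
Proof.
  intros H. assert (HD := profile_D_pos x). assert (HA := A_pos x). assert (Hq := q_pos x).
  assert (Hk := profile_kappa).
  assert (Hx : x * q x = t x * (A x * (q x + 1 - c))).
  { rewrite <- A_q. unfold t. field. lra. }
  replace (x * P1 x) with (- (x * q x * t x / (kappa * c * (q x + 1 - c) ^ 2)) *
  (3 * (1 - c) * (kappa - t x * t x) + 2 * (1 - 2 * c) * t x)).
  2: { unfold P1. field. lra. }
  rewrite Hx. unfold P. set (s := t x) in *. field. repeat split; lra.
Qed.

Lemma profile_P_pos x : t x * t x < kappa -> 0 < P x.
Proof.
  intros H. assert (HD := profile_D_pos x). assert (HA := A_pos x). assert (Hk := profile_kappa).
  unfold P. apply Rmult_lt_0_compat; [apply Rdiv_lt_0_compat; auto|].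
  replace (1 - t x * t x / kappa) with ((kappa - t x * t x) / kappa) by (field; lra).
  apply Rdiv_lt_0_compat; lra.
Qed.

Lemma profile_t_neg_sq x : 0 < x -> t (- x) * t (- x) < kappa.
Proof.
  intros Hx. destruct (profile_t_sign x Hx) as [_ H1].
  assert (H2 := profile_t_lower (- x)). assert (Hk := profile_kappa). nra.
Qed.

(** Supplied by [radius_t_dominates], where [A] and [q] are explicit powers of the radial
    function. *)
Hypothesis t_dominates : forall x, 0 < x -> 0 < t x + t (- x).

(** If [t x ^ 2] has reached [kappa], then [P x <= 0 < P (- x)]. Otherwise [P] is positive on all of
    [[- x, x]], and [ln (P y) - ln (P (- y))] vanishes at [y = 0] and has a negative derivative for
    [y > 0]. *)
Lemma profile_P_asym x : 0 < x -> P x < P (- x).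
Proof.
  intros Hx. assert (Hk := profile_kappa).
  assert (Hn := profile_P_pos (- x) (profile_t_neg_sq x Hx)).
  destruct (Rle_lt_dec kappa (t x * t x)) as [Hb|Hb].
  { apply Rle_lt_trans with 0; auto.
    assert (HD := profile_D_pos x). assert (HA := A_pos x). unfold P.
    assert (H1 : 0 < A x / (q x + 1 - c)) by (apply Rdiv_lt_0_compat; auto).
    assert (H2 : 1 <= t x * t x / kappa).
    { apply (Rmult_le_reg_r kappa); [lra|]. unfold Rdiv. rewrite Rmult_assoc, Rinv_l; lra. }
    nra. }
  assert (t0 : t 0 = 0).
  { assert (H := A_q 0). assert (HA := A_pos 0). unfold t.
    replace (q 0 - c) with 0 by nra. unfold Rdiv; ring. }
  assert (Hsq : forall y, 0 <= y <= x -> t y * t y < kappa /\ t (- y) * t (- y) < kappa).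
  { intros y [[Hy|Hy] Hyx].
    - split; [|apply profile_t_neg_sq; auto].
      assert (H1 := proj1 (profile_t_sign y Hy)).
      assert (H2 : t y <= t x) by (destruct Hyx as [Hyx| ->]; [apply Rlt_le, profile_t_incr; auto|lra]).
      nra.
    - subst y. rewrite Ropp_0, t0. lra. }
  assert (Hd : forall y, 0 <= y <= x ->
    derivable_pt_lim (fun y => ln (P y) - ln (P (- y))) y (P1 y / P y + P1 (- y) / P (- y))).
  { intros y Hy. destruct (Hsq y Hy) as [S1 S2].
    apply profile_P_pos in S1. apply profile_P_pos in S2.
    assert (Hopp : is_derive (fun y : R => - y) y (-1)) by (auto_derive; auto; ring).
    apply is_derive_Reals. evar_last.
    - apply (is_derive_minus (fun y => ln (P y)) (fun y => ln (P (- y)))).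
      + apply (is_derive_comp ln P); [apply is_derive_ln; auto|apply profile_P_derive].
      + apply (is_derive_comp ln (fun y => P (- y))); [apply is_derive_ln; auto|].
        apply (is_derive_comp P (fun y => - y)); [apply profile_P_derive|].
        exact Hopp.
    - unfold minus, plus, opp, scal; simpl. unfold mult, one; simpl. field. lra. }
  destruct (MVT_cor2 _ _ 0 x Hx Hd) as (y & Hy & Hy0 & Hyx).
  destruct (Hsq y ltac:(lra)) as [S1 S2].
  assert (P1y := profile_P_logderive y ltac:(lra)).
  assert (P2y := profile_P_logderive (- y) ltac:(lra)).
  assert (Q1 := profile_P_pos y S1). assert (Q2 := profile_P_pos (- y) S2).
  destruct (profile_t_sign y Hy0) as [T1 T2]. assert (T3 := t_dominates y Hy0).
  assert (V : P1 y / P y + P1 (- y) / P (- y) < 0).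
  (* [O1] and [O2] are minus the logarithmic derivatives at [y] and [- y], multiplied by the point.
     Their last term has the sign of [t], so [O1] lies above [3 (1 - c) t^2 / c] at [y] and [O2]
     below it at [- y]; [t_dominates] orders these two quadratic bounds. *)
  { set (O1 := t y * t y / c * (3 * (1 - c) + 2 * (1 - 2 * c) * t y / (kappa - t y * t y))) in *.
    set (O2 := t (- y) * t (- y) / c * (3 * (1 - c) + 2 * (1 - 2 * c) * t (- y) / (kappa - t (- y) * t (- y)))) in *.
    replace (P1 y) with (- P y * O1 / y) by (rewrite <- P1y; field; lra).
    replace (P1 (- y)) with (P (- y) * O2 / y).
    2: { replace (P (- y) * O2) with (- (- P (- y) * O2)) by ring. rewrite <- P2y. field; lra. }
    replace (- P y * O1 / y / P y + P (- y) * O2 / y / P (- y)) with (- ((O1 - O2) / y)) by (field; lra).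
    assert (0 < (O1 - O2) / y); [|lra]. apply Rdiv_lt_0_compat; auto.
    assert (C1 : t y * t y / c * (3 * (1 - c)) < O1).
    { unfold O1. apply Rmult_lt_compat_l; [apply Rdiv_lt_0_compat; nra|].
      assert (0 < 2 * (1 - 2 * c) * t y / (kappa - t y * t y)); [|lra].
      apply Rdiv_lt_0_compat; [apply Rmult_lt_0_compat; lra|lra]. }
    assert (C2 : O2 < t (- y) * t (- y) / c * (3 * (1 - c))).
    { unfold O2. apply Rmult_lt_compat_l; [apply Rdiv_lt_0_compat; nra|].
      assert (0 < 2 * (1 - 2 * c) * (- t (- y)) / (kappa - t (- y) * t (- y))).
      { apply Rdiv_lt_0_compat; [apply Rmult_lt_0_compat; lra|lra]. }
      unfold Rdiv in *. lra. }
    assert (C3 : t (- y) * t (- y) / c * (3 * (1 - c)) < t y * t y / c * (3 * (1 - c))).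
    { apply Rmult_lt_compat_r; [lra|]. apply Rmult_lt_compat_r; [apply Rinv_0_lt_compat; auto|]. nra. }
    lra. }
  rewrite Ropp_0 in Hy.
  assert (L : ln (P x) < ln (P (- x))) by nra.
  apply ln_lt_inv; auto. apply profile_P_pos; auto.
Qed.

Lemma profile_mean_decreasing h1 h2 :
  0 < h1 < h2 ->
  mean_sin (fun x => / (q x + 1 - c)) h2 < mean_sin (fun x => / (q x + 1 - c)) h1.
Proof.
  apply (mean_sin_decreasing _ _ (fun x => A x / (q x + 1 - c))
    (fun x => (1 - c) * (x * - (q x * q x / (A x * c * (q x + 1 - c) ^ 3))))
    (1 - c) ltac:(lra) profile_E_derive).
  - intros x. assert (HA : continuous A x) by apply (is_derive_continuous_R _ _ _ (A_derive x)).
    assert (Hq : continuous q x) by apply (is_derive_continuous_R _ _ _ (q_derive x)).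
    assert (HD := profile_D_pos x). assert (HAp := A_pos x).
    apply continuity_pt_filterlim. apply continuity_pt_filterlim in HA. apply continuity_pt_filterlim in Hq.
    apply continuity_pt_opp, continuity_pt_div.
    + apply continuity_pt_mult; auto.
    + apply continuity_pt_mult; [apply continuity_pt_mult; auto; apply continuity_pt_const; intros ? ?; auto|].
      assert (HDc : continuity_pt (fun x => q x + 1 - c) x).
      { apply continuity_pt_minus; [apply continuity_pt_plus; auto|]; apply continuity_pt_const; intros ? ?; auto. }
      apply (continuity_pt_mult (fun x => q x + 1 - c)); auto.
      apply (continuity_pt_mult (fun x => q x + 1 - c)); auto.
      apply (continuity_pt_mult (fun x => q x + 1 - c)); auto. apply continuity_pt_const; intros ? ?; auto.
    + apply Rgt_not_eq. repeat apply Rmult_lt_0_compat; auto. lra.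
  - apply profile_K_derive.
  - reflexivity.
  - intros x Hx. rewrite !profile_P_eq. apply profile_P_asym; auto.
Qed.

End Profile.

(** * The radial function and the limits of the period integral *)

Lemma mean_sin_lim_0 (E : R -> R) :
  (forall x, continuous E x) ->
  forall eps, 0 < eps -> exists h0, 0 < h0 /\
    forall h, 0 < h < h0 -> Rabs (mean_sin E h - 2 * PI * E 0) < eps.
Proof.
  intros HE eps Heps. assert (HPI := PI_RGT_0).
  assert (He : 0 < eps / (4 * PI)) by (apply Rdiv_lt_0_compat; lra).
  destruct (proj1 (filterlim_locally _ _) (HE 0) (mkposreal _ He)) as [d Hd].
  exists d. split; [apply cond_pos|]. intros h [Hh1 Hh2].
  assert (Hs : forall x, continuous (fun psi => E (h * sin psi)) x) by (apply (continuous_scal_sin E h HE)).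
  assert (J : RInt (fun psi => E (h * sin psi) - E 0) 0 (2 * PI) = mean_sin E h - 2 * PI * E 0).
  { replace (2 * PI * E 0) with (RInt (fun _ => E 0) 0 (2 * PI)).
    - apply (RInt_minus (V := R_CompleteNormedModule) (fun psi => E (h * sin psi)) (fun _ => E 0));
        apply (ex_RInt_continuous (V := R_CompleteNormedModule)); intros; auto. apply continuous_const.
    - rewrite RInt_const. change ((2 * PI - 0) * E 0 = 2 * PI * E 0). ring. }
  rewrite <- J. apply Rle_lt_trans with ((2 * PI - 0) * (eps / (4 * PI))).
  - apply abs_RInt_le_const; [lra| |].
    + apply (ex_RInt_continuous (V := R_CompleteNormedModule)). intros z _.
      apply (continuous_minus (fun psi => E (h * sin psi))); auto. apply continuous_const.
    + intros t _. apply Rlt_le. specialize (Hd (h * sin t)).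
      apply Hd. change (Rabs (h * sin t - 0) < d).
      rewrite Rminus_0_r, Rabs_mult, (Rabs_pos_eq h) by lra.
      assert (Rabs (sin t) <= 1) by (apply Rabs_le, SIN_bound).
      assert (Hp := Rabs_pos (sin t)). nra.
  - replace ((2 * PI - 0) * (eps / (4 * PI))) with (eps / 2) by (field; lra). lra.
Qed.

(** After folding, the integrand approaches [L] except near [0] and [PI], where [h * sin psi] need
    not be large. These ends are cut off and controlled by the uniform bound [M]. *)
Lemma mean_sin_lim_infty (E : R -> R) (L M : R) :
  (forall x, continuous E x) ->
  (forall x, Rabs (E x + E (- x) - L) <= M) ->
  (forall eps, 0 < eps -> exists X, 0 < X /\ forall x, X <= x -> Rabs (E x + E (- x) - L) <= eps) ->
  forall eps, 0 < eps -> exists h0, 0 < h0 /\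
    forall h, h0 <= h -> Rabs (mean_sin E h - PI * L) < eps.
Proof.
  intros HE HM HL eps Heps. assert (HPI := PI_RGT_0).
  assert (HM0 : 0 <= M) by (apply Rle_trans with (2 := HM 0), Rabs_pos).
  (* Each end piece contributes at most [eps / 8], the middle one at most [eps / 4]. The summand 1
     avoids a division by 0, and [d <= PI / 2] keeps the sine above [sin d] on [[d, PI - d]]. *)
  set (d := Rmin (PI / 2) (eps / (8 * (M + 1)))).
  assert (Hd0 : 0 < d).
  { apply Rmin_glb_lt; [lra|]. apply Rdiv_lt_0_compat; lra. }
  assert (Hd1 : d <= PI / 2) by apply Rmin_l.
  assert (Hd2 : d * M <= eps / 8).
  { apply Rle_trans with (eps / (8 * (M + 1)) * M).
    - apply Rmult_le_compat_r; auto. apply Rmin_r.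
    - apply Rle_trans with (eps / (8 * (M + 1)) * (M + 1)).
      + apply Rmult_le_compat_l; [|lra]. apply Rlt_le, Rdiv_lt_0_compat; lra.
      + right. field. lra. }
  destruct (HL (eps / (4 * PI))) as (X & HX0 & HX); [apply Rdiv_lt_0_compat; lra|].
  assert (Hsd : 0 < sin d) by (apply sin_gt_0; lra).
  exists (X / sin d). split; [apply Rdiv_lt_0_compat; auto|]. intros h Hh.
  set (G := fun psi => E (h * sin psi) + E (h * - sin psi) - L).
  assert (Hs : forall x, continuous (fun psi => E (h * sin psi)) x) by (apply (continuous_scal_sin E h HE)).
  assert (Hs' : forall x, continuous (fun psi => E (h * - sin psi)) x).
  { intros x. apply (continuous_ext (fun psi => E (- h * sin psi))).
    - intros y. f_equal. ring.
    - apply (continuous_scal_sin E (- h) HE). }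
  assert (HG : forall x, continuous G x).
  { intros x. apply (continuous_minus (fun psi => E (h * sin psi) + E (h * - sin psi))); [|apply continuous_const].
    apply (continuous_plus (fun psi => E (h * sin psi))); auto. }
  assert (Hex : forall (g : R -> R) a b, (forall x, continuous g x) -> ex_RInt g a b)
    by (intros g a b Hg; apply (ex_RInt_continuous (V := R_CompleteNormedModule)); intros; apply Hg).
  assert (J : RInt G 0 PI = mean_sin E h - PI * L).
  { unfold mean_sin. rewrite (RInt_sin_fold (fun s => E (h * s))).
    - replace (PI * L) with (RInt (fun _ => L) 0 PI).
      + apply (RInt_minus (V := R_CompleteNormedModule) (fun psi => E (h * sin psi) + E (h * - sin psi)) (fun _ => L));
          apply Hex; intros x; [|apply continuous_const].
        apply (continuous_plus (fun psi => E (h * sin psi))); auto.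
      + rewrite RInt_const. change ((PI - 0) * L = PI * L). ring.
    - intros x. apply (continuous_comp (fun s => h * s) E); auto.
      apply (continuous_Rmult (fun _ => h)); [apply continuous_const|apply continuous_id]. }
  rewrite <- J.
  assert (C1 : RInt G 0 PI = RInt G 0 d + RInt G d (PI - d) + RInt G (PI - d) PI).
  { rewrite <- (RInt_Chasles G 0 d PI), <- (RInt_Chasles G d (PI - d) PI) by (apply Hex, HG).
    change (RInt G 0 d + (RInt G d (PI - d) + RInt G (PI - d) PI) = RInt G 0 d + RInt G d (PI - d) + RInt G (PI - d) PI).
    ring. }
  assert (Hm : forall x, G x = E (h * sin x) + E (- (h * sin x)) - L).
  { intros x. unfold G. do 3 f_equal. ring. }
  assert (B1 : Rabs (RInt G 0 d) <= (d - 0) * M).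
  { apply abs_RInt_le_const; [lra|apply Hex, HG|]. intros; rewrite Hm; auto. }
  assert (B3 : Rabs (RInt G (PI - d) PI) <= (PI - (PI - d)) * M).
  { apply abs_RInt_le_const; [lra|apply Hex, HG|]. intros; rewrite Hm; auto. }
  assert (B2 : Rabs (RInt G d (PI - d)) <= (PI - d - d) * (eps / (4 * PI))).
  { apply abs_RInt_le_const; [lra|apply Hex, HG|]. intros x Hx. rewrite Hm. apply HX.
    assert (Hx2 : sin d <= sin x).
    { destruct (Rle_lt_dec x (PI / 2)) as [H|H].
      - apply sin_incr_1; lra.
      - rewrite <- (sin_PI_x x). apply sin_incr_1; lra. }
    apply Rle_trans with (X / sin d * sin d); [right; field; lra|].
    apply Rmult_le_compat; try lra. apply Rlt_le, Rdiv_lt_0_compat; auto. }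
  assert (B2' : (PI - d - d) * (eps / (4 * PI)) <= eps / 4).
  { apply Rle_trans with (PI * (eps / (4 * PI))).
    - apply Rmult_le_compat_r; [apply Rlt_le, Rdiv_lt_0_compat; lra|lra].
    - right; field; lra. }
  rewrite C1. apply Rle_lt_trans with (Rabs (RInt G 0 d) + Rabs (RInt G d (PI - d)) + Rabs (RInt G (PI - d) PI)).
  { apply Rle_trans with (1 := Rabs_triang _ _). apply Rplus_le_compat_r, Rabs_triang. }
  nra.
Qed.

(** Along orbits [eta' = xi (k + 2(n+k) eta)]; this constant is the shift of [eta] that makes the
    equation homogeneous. *)
Definition cnk (n k : nat) : R := INR k / (2 * (INR n + INR k)).

Lemma exp_INR_mult (j : nat) (v : R) : exp (INR j * v) = exp v ^ j.
Proof.
  induction j as [|j IH].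
  - simpl. rewrite Rmult_0_l. apply exp_0.
  - rewrite S_INR. simpl. rewrite <- IH, <- exp_plus. f_equal. ring.
Qed.

Section Radius.

Variables n k : nat.
Hypothesis n_pos : (0 < n)%nat.
Hypothesis k_pos : (0 < k)%nat.

Let c := cnk n k.

Lemma INR_nk : 1 <= INR n /\ 1 <= INR k.
Proof. split; apply (le_INR 1); lia. Qed.

Lemma cnk_bounds : 0 < cnk n k < 1 / 2.
Proof.
  destruct INR_nk as [H1 H2]. unfold cnk. split.
  - apply Rdiv_lt_0_compat; lra.
  - apply (Rmult_lt_reg_r (2 * (INR n + INR k))); [lra|].
    unfold Rdiv. rewrite Rmult_assoc, Rinv_l; lra.
Qed.

(** In the variable [v = ln w] the defining equation lives on the whole line and has an increasing
    left side, so [inverse_function] applies; exponentiating yields a positive [W]. *)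
Lemma radius_exists :
  exists W : R -> R,
    (forall x, 0 < W x) /\
    (forall x, W x ^ k - c / W x ^ (2 * n + k) = x) /\
    (forall x, is_derive W x (W x ^ S (2 * n + k) / (INR k * (W x ^ (2 * (n + k)) + 1 - c)))).
Proof.
  destruct INR_nk as [Hn Hk]. assert (Hc := cnk_bounds). fold c in Hc.
  set (m := (2 * n + k)%nat).
  assert (Hm : INR m = 2 * INR n + INR k) by (unfold m; rewrite plus_INR, mult_INR; simpl; ring).
  set (f := fun v => exp (INR k * v) - c * exp (- (INR m * v))).
  set (f' := fun v => INR k * exp (INR k * v) + c * INR m * exp (- (INR m * v))).
  destruct (inverse_function f f') as (g & Hg1 & Hg2).
  - intros x. unfold f, f'. auto_derive; auto. ring.
  - intros x. unfold f'. assert (H1 := exp_pos (INR k * x)). assert (H2 := exp_pos (- (INR m * x))).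
    apply Rplus_lt_0_compat; [apply Rmult_lt_0_compat; lra|].
    apply Rmult_lt_0_compat; [apply Rmult_lt_0_compat; lra|lra].
  (* By [exp z >= 1 + z], the negative term at the left end is at most [- (c + 1 + |y|)] while the
     other is at most 1. At the right end the positive term is at least [1 + |y|] and the other one
     costs at most [c]. *)
  - intros y. exists (- ((1 + Rabs y) / c)), (Rabs y).
    assert (Hy := Rle_abs y). assert (Hy' := Rle_abs (- y)). rewrite Rabs_Ropp in Hy'.
    assert (Hy0 := Rabs_pos y).
    assert (Hexp : forall z, 0 <= z -> 1 + z <= exp z).
    { intros z [Hz| <-]; [apply Rlt_le, exp_ineq1; lra|rewrite exp_0; lra]. }
    assert (Hexn : forall z, z <= 0 -> exp z <= 1).
    { intros z [Hz| ->]; [rewrite <- exp_0; apply Rlt_le, exp_increasing; auto|rewrite exp_0; lra]. }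
    split; unfold f.
    + set (v := (1 + Rabs y) / c).
      assert (Hv : 0 < v) by (apply Rdiv_lt_0_compat; lra).
      assert (cv : c * v = 1 + Rabs y) by (unfold v; field; lra).
      assert (H1 := Hexn (INR k * - v) ltac:(nra)).
      assert (H2 := Hexp (- (INR m * - v)) ltac:(nra)).
      assert (v <= - (INR m * - v)) by nra.
      assert (c * (1 + v) <= c * exp (- (INR m * - v))) by (apply Rmult_le_compat_l; lra).
      nra.
    + assert (H1 := Hexp (INR k * Rabs y) ltac:(nra)).
      assert (H2 := Hexn (- (INR m * Rabs y)) ltac:(nra)).
      assert (H3 := exp_pos (- (INR m * Rabs y))). nra.
  - exists (fun x => exp (g x)). split; [intros; apply exp_pos|]. split.
    + intros x. rewrite <- (Hg1 x) at 3. unfold f. rewrite exp_Ropp, !exp_INR_mult. reflexivity.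
    + intros x. evar_last.
      * apply (is_derive_comp exp g); [apply is_derive_exp|apply Hg2].
      * change (/ f' (g x) * exp (g x) = exp (g x) ^ S m / (INR k * (exp (g x) ^ (2 * (n + k)) + 1 - c))).
        unfold f'. rewrite exp_Ropp, !exp_INR_mult.
        replace (2 * (n + k))%nat with (m + k)%nat by (unfold m; lia).
        rewrite pow_add. simpl pow.
        assert (HA := pow_lt _ k (exp_pos (g x))). assert (HB := pow_lt _ m (exp_pos (g x))).
        set (A := exp (g x) ^ k) in *. set (B := exp (g x) ^ m) in *. set (w := exp (g x)).
        (* This relation merges the two terms of [f'] into [k (q + 1 - c) / w^m], the origin of the
           denominator in [E]. *)
        assert (Hck : c * INR m = INR k * (1 - c)) by (rewrite Hm; unfold c, cnk; field; lra).
        rewrite Hck. field. repeat split; try lra; apply Rgt_not_eq.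
        -- assert (0 < B * A) by (apply Rmult_lt_0_compat; auto). lra.
        -- assert (0 < INR k * A * B) by (repeat apply Rmult_lt_0_compat; lra). nra.
Qed.

Variable W : R -> R.
Hypothesis W_pos : forall x, 0 < W x.
Hypothesis W_eq : forall x, W x ^ k - c / W x ^ (2 * n + k) = x.
Hypothesis W_derive : forall x,
  is_derive W x (W x ^ S (2 * n + k) / (INR k * (W x ^ (2 * (n + k)) + 1 - c))).

Let A x := W x ^ k.
Let B x := W x ^ (2 * n + k).
Let q x := W x ^ (2 * (n + k)).

Lemma radius_q x : q x = A x * B x.
Proof. unfold q, A, B. rewrite <- pow_add. f_equal. lia. Qed.

Lemma radius_A_pos x : 0 < A x.
Proof. apply pow_lt, W_pos. Qed.

Lemma radius_B_pos x : 0 < B x.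
Proof. apply pow_lt, W_pos. Qed.

Lemma radius_q_pos x : 0 < q x.
Proof. apply pow_lt, W_pos. Qed.

Lemma radius_x_B x : x * B x = q x - c.
Proof.
  assert (HB := radius_B_pos x). rewrite radius_q.
  replace x with (A x - c / B x) at 1 by apply W_eq. field. lra.
Qed.

Lemma radius_A_q x : A x * (q x - c) = x * q x.
Proof. rewrite <- radius_x_B, radius_q. ring. Qed.

Lemma radius_A_derive x : is_derive A x (q x / (q x + 1 - c)).
Proof.
  destruct INR_nk as [Hn Hk]. assert (Hc := cnk_bounds). fold c in Hc.
  assert (Hq := radius_q_pos x). evar_last.
  - apply is_derive_pow, W_derive.
  - fold (q x). change (W x ^ S (2 * n + k)) with (W x * B x).
    assert (E : W x ^ pred k * W x = A x).
    { unfold A. replace k with (S (pred k)) at 2 by lia. simpl pow. ring. }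
    rewrite (radius_q x) at 2. rewrite <- E. field. lra.
Qed.

Lemma radius_q_derive x : is_derive q x (q x * q x / (A x * c * (q x + 1 - c))).
Proof.
  destruct INR_nk as [Hn Hk]. assert (Hc := cnk_bounds). fold c in Hc.
  assert (Hq := radius_q_pos x). assert (HA := radius_A_pos x). assert (HB := radius_B_pos x). evar_last.
  - apply is_derive_pow, W_derive.
  - fold (q x). change (W x ^ S (2 * n + k)) with (W x * B x).
    assert (E : W x ^ pred (2 * (n + k)) * W x = q x).
    { unfold q. replace (2 * (n + k))%nat with (S (pred (2 * (n + k)))) at 2 by lia. simpl pow. ring. }
    replace (q x * q x) with (q x * (A x * B x)) by (rewrite <- radius_q; ring).
    rewrite <- E at 2.
    replace (INR (2 * (n + k))) with (INR k / c).
    2: { rewrite mult_INR, plus_INR. simpl (INR 2). unfold c, cnk. field. lra. }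
    field. repeat split; lra.
Qed.

(** With [X = 1 / t x] and [Y = - 1 / t (- x)] the claim is [X < Y]. Eliminating [W] at [x] and at
    [- x] gives a polynomial equation between [X] and [Y] whose left side increases in [X]. If
    [Y <= X], that side is at least its value at [Y], which already exceeds the right side. *)
Lemma radius_t_dominates x :
  0 < x -> 0 < (q x - c) / (q x + 1 - c) + (q (- x) - c) / (q (- x) + 1 - c).
Proof.
  intros Hx. assert (Hc := cnk_bounds). fold c in Hc.
  assert (Hq1 := radius_q_pos x). assert (Hq2 := radius_q_pos (- x)).
  assert (HB1 := radius_B_pos x). assert (HB2 := radius_B_pos (- x)).
  assert (X1 := radius_x_B x). assert (X2 := radius_x_B (- x)).
  assert (r1 : 0 < q x - c) by nra. assert (r2 : 0 < c - q (- x)) by nra.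
  set (p := q x - c) in *. set (r := c - q (- x)) in *.
  set (X := (p + 1) / p). set (Y := (1 - r) / r).
  assert (Hr : r < 1 / 2) by (unfold r; lra).
  assert (EX : (q x - c) / (q x + 1 - c) = / X) by (unfold X, p; field; unfold p in *; lra).
  assert (EY : (q (- x) - c) / (q (- x) + 1 - c) = - / Y) by (unfold Y, r in *; field; lra).
  fold p in EX. rewrite EX, EY.
  assert (HY : (1 - c) / c < Y).
  { unfold Y. apply (Rmult_lt_reg_r (c * r)); [nra|]. replace ((1 - c) / c * (c * r)) with ((1 - c) * r) by (field; lra).
    replace ((1 - r) / r * (c * r)) with ((1 - r) * c) by (field; lra). unfold r in *. nra. }
  assert (Hk1 : 1 < (1 - c) / c).
  { apply (Rmult_lt_reg_r c); [lra|]. unfold Rdiv. rewrite Rmult_assoc, Rinv_l; lra. }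
  assert (HX0 : 0 < X) by (apply Rdiv_lt_0_compat; lra).
  assert (HXY : X < Y); [|apply Rinv_lt_contravar in HXY; nra].
  destruct (Rlt_le_dec X Y) as [H|H]; auto. exfalso.
  (* Both sides equal [x ^ -(2 * (n + k))]. *)
  assert (EQ : (c * X + (1 - c)) ^ (2 * n + k) * (X - 1) ^ k = (c * Y - (1 - c)) ^ (2 * n + k) * (Y + 1) ^ k).
  { assert (P1 : x ^ (2 * (n + k)) * ((c * X + (1 - c)) ^ (2 * n + k) * (X - 1) ^ k) = 1).
    { replace (c * X + (1 - c)) with (q x * / p) by (unfold X; replace (q x) with (p + c) by (unfold p; ring); field; lra).
      replace (X - 1) with (/ p) by (unfold X; field; lra).
      rewrite Rpow_mult_distr, Rmult_assoc, <- pow_add.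
      replace (2 * n + k + k)%nat with (2 * (n + k))%nat by lia.
      replace (q x ^ (2 * n + k)) with (B x ^ (2 * (n + k))) by (unfold q, B; rewrite <- !pow_mult; f_equal; lia).
      rewrite <- !Rpow_mult_distr. replace (x * (B x * / p)) with 1 by (rewrite <- Rmult_assoc, X1; field; lra).
      apply pow1. }
    assert (P2 : x ^ (2 * (n + k)) * ((c * Y - (1 - c)) ^ (2 * n + k) * (Y + 1) ^ k) = 1).
    { replace (c * Y - (1 - c)) with (q (- x) * / r) by (unfold Y; replace (q (- x)) with (c - r) by (unfold r; ring); field; lra).
      replace (Y + 1) with (/ r) by (unfold Y; field; lra).
      rewrite Rpow_mult_distr, Rmult_assoc, <- pow_add.
      replace (2 * n + k + k)%nat with (2 * (n + k))%nat by lia.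
      replace (q (- x) ^ (2 * n + k)) with (B (- x) ^ (2 * (n + k))) by (unfold q, B; rewrite <- !pow_mult; f_equal; lia).
      rewrite <- !Rpow_mult_distr.
      replace (x * (B (- x) * / r)) with 1.
      2: { replace (x * (B (- x) * / r)) with (- (- x * B (- x)) * / r) by ring. rewrite X2.
           replace (- (q (- x) - c)) with r by (unfold r; ring). field. lra. }
      apply pow1. }
    apply (Rmult_eq_reg_l (x ^ (2 * (n + k)))); [rewrite P1, P2; auto|]. apply pow_nonzero. lra. }
  assert (HYv : 0 < c * Y - (1 - c)).
  { apply (Rmult_lt_compat_l c) in HY; [|lra]. replace (c * ((1 - c) / c)) with (1 - c) in HY by (field; lra). lra. }
  assert (I1 : (c * Y + (1 - c)) ^ (2 * n + k) * (Y - 1) ^ k <= (c * X + (1 - c)) ^ (2 * n + k) * (X - 1) ^ k).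
  { apply Rmult_le_compat; try (apply pow_le; nra); apply pow_incr; nra. }
  assert (I2 : (c * Y - (1 - c)) ^ (2 * n + k) * (Y + 1) ^ k < (c * Y + (1 - c)) ^ (2 * n + k) * (Y - 1) ^ k).
  (* Of the [2n + k] equal factors, [k] are paired with the other power: [(c Y + (1 - c)) (Y - 1)]
     exceeds [(c Y - (1 - c)) (Y + 1)] by [2 (1 - 2c) Y]. The remaining [2n] factors give
     strictness. *)
  { rewrite !pow_add, !Rmult_assoc, <- !Rpow_mult_distr.
    apply Rlt_le_trans with ((c * Y + (1 - c)) ^ (2 * n) * ((c * Y - (1 - c)) * (Y + 1)) ^ k).
    - apply Rmult_lt_compat_r; [apply pow_lt; nra|].
      apply pow_strict_incr; [lra|lia].
    - apply Rmult_le_compat_l; [apply pow_le; nra|]. apply pow_incr. nra. }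
  lra.
Qed.

Lemma radius_mean_decreasing h1 h2 :
  0 < h1 < h2 ->
  mean_sin (fun x => / (q x + 1 - c)) h2 < mean_sin (fun x => / (q x + 1 - c)) h1.
Proof.
  assert (Hc := cnk_bounds). fold c in Hc.
  apply (profile_mean_decreasing c A q (proj1 Hc) (proj2 Hc) radius_A_pos radius_q_pos
    radius_A_derive radius_q_derive radius_A_q radius_t_dominates).
Qed.

Lemma radius_E_continuous x : continuous (fun x => / (q x + 1 - c)) x.
Proof.
  assert (Hc := cnk_bounds). fold c in Hc.
  eapply is_derive_continuous_R.
  apply (profile_E_derive c A q (proj1 Hc) (proj2 Hc) radius_A_pos radius_q_pos radius_q_derive).
Qed.

Lemma radius_E_0 : / (q 0 + 1 - c) = 1.
Proof. assert (H := radius_x_B 0). replace (q 0 + 1 - c) with 1 by lra. apply Rinv_1. Qed.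

Lemma radius_E_bounds x : 0 < / (q x + 1 - c) < 2.
Proof.
  assert (Hc := cnk_bounds). fold c in Hc. assert (Hq := radius_q_pos x). split.
  - apply Rinv_0_lt_compat. lra.
  - apply (Rmult_lt_reg_r (q x + 1 - c)); [lra|]. rewrite Rinv_l; lra.
Qed.

Lemma radius_E_antitone x y : x <= y -> / (q y + 1 - c) <= / (q x + 1 - c).
Proof.
  intros [H| ->]; [|lra].
  assert (Hc := cnk_bounds). fold c in Hc.
  assert (T := profile_t_incr c A q (proj1 Hc) (proj2 Hc) radius_A_pos radius_q_pos radius_q_derive x y H).
  simpl in T. assert (Hq := radius_q_pos x). assert (Hq' := radius_q_pos y).
  replace ((q x - c) / (q x + 1 - c)) with (1 - / (q x + 1 - c)) in T by (field; lra).
  replace ((q y - c) / (q y + 1 - c)) with (1 - / (q y + 1 - c)) in T by (field; lra).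
  lra.
Qed.

(** A crude bound suffices: with [radius_q_le] it sends [E x] to 0 and [E (- x)] to [1 / (1 - c)],
    both with an error of order [1 / x]. *)
Lemma radius_q_ge x : 1 <= x -> x <= q x.
Proof.
  intros Hx. assert (Hc := cnk_bounds). fold c in Hc. assert (HA := radius_A_pos x). assert (HB := radius_B_pos x).
  assert (H := W_eq x). fold (A x) (B x) in H.
  assert (0 < c / B x) by (apply Rdiv_lt_0_compat; lra).
  assert (HW : 1 <= W x).
  { destruct (Rle_lt_dec 1 (W x)) as [HW|HW]; auto. exfalso.
    assert (A x <= 1); [|lra]. unfold A. rewrite <- (pow1 k). apply pow_incr. split; [apply Rlt_le, W_pos|lra]. }
  assert (1 <= B x) by (apply pow_R1_Rle; auto).
  rewrite radius_q. nra.
Qed.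

Lemma radius_q_le x : 1 <= x -> q (- x) <= c / x.
Proof.
  intros Hx. assert (Hc := cnk_bounds). fold c in Hc. assert (HA := radius_A_pos (- x)). assert (HB := radius_B_pos (- x)).
  assert (H := radius_x_B (- x)). assert (Hq := radius_q_pos (- x)).
  assert (HBx : B (- x) <= c / x).
  { apply (Rmult_le_reg_r x); [lra|]. unfold Rdiv. rewrite Rmult_assoc, Rinv_l; lra. }
  assert (Hcx : c / x < 1).
  { apply (Rmult_lt_reg_r x); [lra|]. unfold Rdiv. rewrite Rmult_assoc, Rinv_l; lra. }
  assert (HW : W (- x) <= 1).
  { destruct (Rle_lt_dec (W (- x)) 1) as [HW|HW]; auto. exfalso.
    assert (1 <= B (- x)); [|lra]. apply pow_R1_Rle. lra. }
  assert (A (- x) <= 1).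
  { unfold A. rewrite <- (pow1 k). apply pow_incr. split; [apply Rlt_le, W_pos|lra]. }
  rewrite radius_q. nra.
Qed.

Lemma radius_E_sum_lim eps :
  0 < eps -> exists X, 0 < X /\ forall x, X <= x ->
    Rabs (/ (q x + 1 - c) + / (q (- x) + 1 - c) - / (1 - c)) <= eps.
Proof.
  intros He. assert (Hc := cnk_bounds). fold c in Hc.
  (* The 1 gives access to the bounds on [q]; the 3 adds up the errors [1 / x] and [2 / x] of the
     two summands. *)
  exists (1 + 3 / eps). assert (H3 : 0 < 3 / eps) by (apply Rdiv_lt_0_compat; lra). split; [lra|].
  intros x Hx.
  assert (Q1 := radius_q_ge x ltac:(lra)). assert (Q2 := radius_q_le x ltac:(lra)).
  assert (Hq := radius_q_pos (- x)).
  assert (E1 : 0 < / (q x + 1 - c) <= / x).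
  { split; [apply Rinv_0_lt_compat; lra|]. apply Rinv_le_contravar; lra. }
  assert (E2 : 0 <= / (1 - c) - / (q (- x) + 1 - c) <= 2 * / x).
  { replace (/ (1 - c) - / (q (- x) + 1 - c)) with (q (- x) / ((1 - c) * (q (- x) + 1 - c))) by (field; lra).
    split; [apply Rlt_le, Rdiv_lt_0_compat; nra|].
    apply Rle_trans with (c / x / ((1 - c) * (1 - c))).
    - unfold Rdiv at 1 2. apply Rmult_le_compat; auto; try lra.
      + apply Rlt_le, Rinv_0_lt_compat. nra.
      + apply Rinv_le_contravar; nra.
    - unfold Rdiv. rewrite (Rmult_comm c), Rmult_assoc, (Rmult_comm 2).
      apply Rmult_le_compat_l; [lra|].
      apply (Rmult_le_reg_r ((1 - c) * (1 - c))); [nra|]. rewrite Rmult_assoc, Rinv_l; nra. }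
  assert (E3 : 3 * / x <= eps).
  { apply (Rmult_le_reg_r x); [lra|]. rewrite Rmult_assoc, Rinv_l by lra.
    replace (3 * 1) with (eps * (3 / eps)) by (field; lra). apply Rmult_le_compat_l; lra. }
  apply Rabs_le. lra.
Qed.

Lemma radius_mean_lim_infty eps :
  0 < eps -> exists h0, 0 < h0 /\ forall h, h0 <= h ->
    Rabs (mean_sin (fun x => / (q x + 1 - c)) h - PI * / (1 - c)) < eps.
Proof.
  apply (mean_sin_lim_infty (fun x => / (q x + 1 - c)) (/ (1 - c)) 4).
  - apply radius_E_continuous.
  - intros x. assert (H1 := radius_E_bounds x). assert (H2 := radius_E_bounds (- x)).
    assert (Hc := cnk_bounds). fold c in Hc.
    assert (0 < / (1 - c) < 2).
    { split; [apply Rinv_0_lt_compat; lra|]. apply (Rmult_lt_reg_r (1 - c)); [lra|]. rewrite Rinv_l; lra. }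
    apply Rabs_le. lra.
  - apply radius_E_sum_lim.
Qed.

Lemma radius_mean_lim_0 eps :
  0 < eps -> exists h0, 0 < h0 /\ forall h, 0 < h < h0 ->
    Rabs (mean_sin (fun x => / (q x + 1 - c)) h - 2 * PI) < eps.
Proof.
  intros He. destruct (mean_sin_lim_0 (fun x => / (q x + 1 - c)) radius_E_continuous eps He) as (h0 & Hh0 & H).
  exists h0. split; auto. intros h Hh. specialize (H h Hh). simpl in H. rewrite radius_E_0, Rmult_1_r in H. auto.
Qed.

End Radius.

(** * Periodic orbits *)

Lemma is_derive_pair (f g : R -> R) (t l m : R) :
  is_derive f t l -> is_derive g t m ->
  is_derive (V := prod_NormedModule R_AbsRing R_NormedModule R_NormedModule)
    (fun t => (f t, g t)) t (l, m).
Proof.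
  intros Hf Hg.
  set (V := prod_NormedModule R_AbsRing R_NormedModule R_NormedModule).
  assert (H : is_derive (V := V) (fun t => plus (scal (f t) ((1, 0) : V)) (scal (g t) ((0, 1) : V))) t
    (plus (scal l ((1, 0) : V)) (scal m ((0, 1) : V)))).
  { apply (is_derive_plus (V := V)); apply (is_derive_scal_l (V := V)); auto. }
  assert (E : forall a b : R, plus (scal a ((1, 0) : V)) (scal b ((0, 1) : V)) = (a, b)).
  { intros a b. unfold plus, scal; simpl. unfold prod_plus, prod_scal, plus, scal; simpl. unfold mult; simpl. f_equal; ring. }
  rewrite E in H. apply (is_derive_ext (V := V)) with (2 := H). intros s. apply E.
Qed.

Lemma is_derive_fst (f : R -> R * R) (t : R) (l : R * R) :
  is_derive (V := prod_NormedModule R_AbsRing R_NormedModule R_NormedModule) f t l ->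
  is_derive (fun t => fst (f t)) t (fst l).
Proof.
  intros H.
  apply (filterdiff_comp' (K := R_AbsRing) (V := prod_NormedModule R_AbsRing R_NormedModule R_NormedModule)
    f fst t _ fst H).
  apply filterdiff_linear, is_linear_fst.
Qed.

Lemma is_derive_snd (f : R -> R * R) (t : R) (l : R * R) :
  is_derive (V := prod_NormedModule R_AbsRing R_NormedModule R_NormedModule) f t l ->
  is_derive (fun t => snd (f t)) t (snd l).
Proof.
  intros H.
  apply (filterdiff_comp' (K := R_AbsRing) (V := prod_NormedModule R_AbsRing R_NormedModule R_NormedModule)
    f snd t _ snd H).
  apply filterdiff_linear, is_linear_snd.
Qed.

Lemma polar_exists (p : R * R) :
  p <> (0, 0) -> exists r theta, 0 < r /\ p = (r * cos theta, r * sin theta).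
Proof.
  destruct p as [x y]. intros Hp.
  assert (Hn : 0 < x * x + y * y).
  { assert (H1 := Rle_0_sqr x). assert (H2 := Rle_0_sqr y). unfold Rsqr in *.
    destruct (Req_dec (x * x + y * y) 0) as [H|H]; [|lra].
    exfalso. apply Hp. f_equal; apply Rsqr_0_uniq; unfold Rsqr; lra. }
  set (r := sqrt (x * x + y * y)).
  assert (Hr : 0 < r) by (apply sqrt_lt_R0; auto).
  assert (Hrr : r * r = x * x + y * y) by (apply sqrt_sqrt; lra).
  assert (Hb : -1 <= x / r <= 1).
  { split; apply (Rmult_le_reg_r r); auto; unfold Rdiv; rewrite Rmult_assoc, Rinv_l by lra; nra. }
  assert (Hs : sin (acos (x / r)) = Rabs y / r).
  { rewrite sin_acos by auto.
    replace (1 - Rsqr (x / r)) with (Rsqr (Rabs y / r)).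
    - rewrite sqrt_Rsqr; auto. apply Rmult_le_pos; [apply Rabs_pos|apply Rlt_le, Rinv_0_lt_compat; auto].
    - unfold Rsqr. assert (Hyy : Rabs y * Rabs y = y * y) by (rewrite <- Rabs_mult; apply Rabs_pos_eq; nra).
      apply (Rmult_eq_reg_r (r * r)); [|nra].
      replace (Rabs y / r * (Rabs y / r) * (r * r)) with (Rabs y * Rabs y) by (field; lra).
      replace ((1 - x / r * (x / r)) * (r * r)) with (r * r - x * x) by (field; lra). lra. }
  exists r. destruct (Rle_lt_dec 0 y) as [Hy|Hy].
  - exists (acos (x / r)). split; auto. rewrite cos_acos, Hs, Rabs_pos_eq by auto.
    f_equal; field; lra.
  - exists (- acos (x / r)). split; auto. rewrite cos_neg, sin_neg, cos_acos, Hs, Rabs_left by auto.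
    f_equal; field; lra.
Qed.

Lemma cpow_polar (r theta : R) (j : nat) :
  cpow (r * cos theta, r * sin theta) j = (r ^ j * cos (INR j * theta), r ^ j * sin (INR j * theta)).
Proof.
  induction j as [|j IH].
  - simpl. rewrite Rmult_0_l, cos_0, sin_0. f_equal; ring.
  - rewrite S_INR. simpl cpow. rewrite IH. unfold cmul; simpl.
    replace ((INR j + 1) * theta) with (theta + INR j * theta) by ring.
    rewrite cos_plus, sin_plus. f_equal; ring.
Qed.

(** The right side is the Cartesian velocity of a point with [r' = r rho cos psi] and
    [theta' = 1 + rho sin psi]. *)
Lemma field_polar (alpha phi r theta : R) (n k : nat) :
  let rho := alpha * r ^ (2 * n + k) in
  let psi := INR k * theta + phi in
  field (alpha * cos phi, alpha * sin phi) n k (r * cos theta, r * sin theta) =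
  (r * (rho * cos psi) * cos theta - r * sin theta * (1 + rho * sin psi),
   r * (rho * cos psi) * sin theta + r * cos theta * (1 + rho * sin psi)).
Proof.
  intros rho psi. unfold field, znorm2. rewrite cpow_polar. cbn -[pow cpow INR].
  unfold cadd, cmul, cscal, ci. cbn -[pow INR Nat.mul Nat.add].
  assert (S := sin2_cos2 theta). unfold Rsqr in S.
  replace (r * cos theta * (r * cos theta) + r * sin theta * (r * sin theta)) with (r ^ 2).
  2: { transitivity (r * r * (sin theta * sin theta + cos theta * cos theta)); [rewrite S|]; ring. }
  rewrite <- pow_mult, plus_INR. simpl (INR 1).
  replace ((INR k + 1) * theta) with ((psi + theta) - phi) by (unfold psi; ring).
  set (chi := psi + theta).
  assert (C1 : cos phi * cos (chi - phi) - sin phi * sin (chi - phi) = cos chi).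
  { rewrite <- cos_plus. f_equal. ring. }
  assert (C2 : sin phi * cos (chi - phi) + cos phi * sin (chi - phi) = sin chi).
  { rewrite <- sin_plus. f_equal. ring. }
  assert (R1 : alpha * (r ^ (2 * n) * r ^ (k + 1)) = r * rho).
  { unfold rho. rewrite !pow_add. simpl (r ^ 1). ring. }
  f_equal.
  - transitivity (- (r * sin theta) + alpha * (r ^ (2 * n) * r ^ (k + 1)) *
      (cos phi * cos (chi - phi) - sin phi * sin (chi - phi))); [ring|].
    rewrite C1, R1. unfold chi. rewrite cos_plus. ring.
  - transitivity (r * cos theta + alpha * (r ^ (2 * n) * r ^ (k + 1)) *
      (sin phi * cos (chi - phi) + cos phi * sin (chi - phi))); [ring|].
    rewrite C2, R1. unfold chi. rewrite sin_plus. ring.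
Qed.

Lemma is_derive_RInt_continuous (g : R -> R) (a x : R) :
  (forall x, continuous g x) -> is_derive (fun x => RInt g a x) x (g x).
Proof.
  intros Hg. apply (is_derive_RInt g (fun x => RInt g a x) a); auto.
  apply filter_forall. intros y. apply (RInt_correct (V := R_CompleteNormedModule)).
  apply (ex_RInt_continuous (V := R_CompleteNormedModule)). auto.
Qed.

Lemma RInt_shift_period (g : R -> R) (x : R) :
  (forall x, continuous g x) -> (forall x, g (x + 2 * PI) = g x) ->
  RInt g 0 (x + 2 * PI) = RInt g 0 x + RInt g 0 (2 * PI).
Proof.
  intros Hg Hp.
  set (G := fun x => RInt g 0 (x + 2 * PI) - RInt g 0 x).
  assert (HG : forall y, is_derive G y 0).
  { intros y. evar_last.
    - apply (is_derive_minus (fun x => RInt g 0 (x + 2 * PI))).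
      + apply (is_derive_comp (fun x => RInt g 0 x) (fun x => x + 2 * PI)).
        * apply is_derive_RInt_continuous; auto.
        * instantiate (1 := 1). auto_derive; auto.
      + apply is_derive_RInt_continuous; auto.
    - change (1 * g (y + 2 * PI) - g y = 0). rewrite Hp. ring. }
  assert (E : G x = G 0).
  { destruct (Rtotal_order x 0) as [H|[->|H]]; auto.
    - apply (eq_is_derive G x 0); auto.
    - symmetry. apply (eq_is_derive G 0 x); auto. }
  unfold G in E. rewrite RInt_point, Rplus_0_l in E.
  change (zero : R) with 0 in E. lra.
Qed.

Lemma RInt_multi_period (g : R -> R) (j : nat) (a : R) :
  (forall x, continuous g x) -> (forall x, g (x + 2 * PI) = g x) ->
  RInt g 0 (INR j * (2 * PI) + a) = INR j * RInt g 0 (2 * PI) + RInt g 0 a.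
Proof.
  intros Hg Hp. induction j as [|j IH].
  - simpl. rewrite !Rmult_0_l, !Rplus_0_l. reflexivity.
  - rewrite S_INR. replace ((INR j + 1) * (2 * PI) + a) with (INR j * (2 * PI) + a + 2 * PI) by ring.
    rewrite RInt_shift_period, IH by auto. lra.
Qed.

(** During one turn of [theta] the argument runs through [j] periods, [j] times as fast, and the two
    factors cancel. This is what replaces [k theta + phi] by [psi] in the period. *)
Lemma RInt_multi_angle (g : R -> R) (j : nat) (phi : R) :
  (0 < j)%nat -> (forall x, continuous g x) -> (forall x, g (x + 2 * PI) = g x) ->
  RInt (fun theta => g (INR j * theta + phi)) 0 (2 * PI) = RInt g 0 (2 * PI).
Proof.
  intros Hj Hg Hp. assert (Hj' : 1 <= INR j) by (apply (le_INR 1); lia).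
  assert (Hex : forall (f : R -> R) a b, (forall x, continuous f x) -> ex_RInt f a b)
    by (intros f a b Hf; apply (ex_RInt_continuous (V := R_CompleteNormedModule)); intros; apply Hf).
  assert (Hc : forall x, continuous (fun theta => g (INR j * theta + phi)) x).
  { intros x. apply (continuous_comp (fun theta => INR j * theta + phi) g); auto.
    apply (ex_derive_continuous (fun theta => INR j * theta + phi)). auto_derive; auto. }
  assert (E : INR j * RInt (fun theta => g (INR j * theta + phi)) 0 (2 * PI) = INR j * RInt g 0 (2 * PI)).
  { assert (C := RInt_comp_lin (V := R_CompleteNormedModule) g (INR j) phi 0 (2 * PI) (Hex _ _ _ Hg)).
    rewrite (RInt_scal (V := R_CompleteNormedModule) (fun theta => g (INR j * theta + phi))) in C by (apply Hex, Hc).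
    change (INR j * RInt (fun theta => g (INR j * theta + phi)) 0 (2 * PI) =
      RInt g (INR j * 0 + phi) (INR j * (2 * PI) + phi)) in C.
    rewrite C, Rmult_0_r, Rplus_0_l.
    assert (D := RInt_Chasles (V := R_CompleteNormedModule) g 0 phi (INR j * (2 * PI) + phi) (Hex _ _ _ Hg) (Hex _ _ _ Hg)).
    change (RInt g 0 phi + RInt g phi (INR j * (2 * PI) + phi) = RInt g 0 (INR j * (2 * PI) + phi)) in D.
    rewrite RInt_multi_period in D by auto. lra. }
  apply (Rmult_eq_reg_l (INR j)); auto. lra.
Qed.

(** Here [g] is [dt/dtheta], so its integral is the time as a function of the angle and [Theta] is
    the inverse. The lower bound [e] makes that integral surjective, hence [Theta] is defined for
    all times. *)
Lemma clock_exists (g : R -> R) (e theta0 : R) :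
  0 < e -> (forall x, continuous g x) -> (forall x, e <= g x) -> (forall x, g (x + 2 * PI) = g x) ->
  let T : R := RInt g 0 (2 * PI) in
  0 < T /\ exists Theta : R -> R,
    Theta 0 = theta0 /\ (forall t, is_derive Theta t (/ g (Theta t))) /\
    (forall t, Theta (t + T) = Theta t + 2 * PI) /\
    (forall s, 0 < s < T -> theta0 < Theta s < theta0 + 2 * PI).
Proof.
  intros He Hg Hge Hp T. assert (HPI := PI_RGT_0).
  set (F := fun x : R => RInt g 0 x : R).
  assert (HF : forall x, is_derive F x (g x)) by (intros x; apply is_derive_RInt_continuous; auto).
  assert (Hgp : forall x, 0 < g x) by (intros x; apply Rlt_le_trans with e; auto).
  assert (Fi := incr_lt F g HF Hgp).
  assert (F0 : F 0 = 0) by exact (RInt_point (V := R_CompleteNormedModule) 0 g).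
  assert (HT : 0 < T) by (rewrite <- F0; apply Fi; lra).
  split; auto.
  assert (Hmv : forall x, 0 <= x -> e * x <= F x /\ F (- x) <= - (e * x)).
  { assert (M : forall u v, u <= v -> e * (v - u) <= F v - F u).
    { intros u v Huv.
      destruct (MVT_gen F u v g) as (z & _ & Hz).
      - intros; apply HF.
      - intros y _. apply continuity_pt_filterlim. apply (is_derive_continuous_R F y (g y)), HF.
      - rewrite Hz. apply Rmult_le_compat_r; [lra|auto]. }
    intros x Hx. assert (M1 := M 0 x Hx). assert (M2 := M (- x) 0 ltac:(lra)). lra. }
  destruct (inverse_function F g HF Hgp) as (G & HG1 & HG2).
  { intros y. exists (- (Rabs y / e)), (Rabs y / e).
    assert (Hy : 0 <= Rabs y / e) by (apply Rmult_le_pos; [apply Rabs_pos|apply Rlt_le, Rinv_0_lt_compat; auto]).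
    destruct (Hmv _ Hy) as [M1 M2]. replace (e * (Rabs y / e)) with (Rabs y) in * by (field; lra).
    assert (A1 := Rle_abs y). assert (A2 := Rle_abs (- y)). rewrite Rabs_Ropp in A2. lra. }
  assert (Finj : forall x y, F x = F y -> x = y).
  { intros x y H. destruct (Rtotal_order x y) as [L|[L|L]]; auto; apply Fi in L; lra. }
  assert (Flt : forall x y, F x < F y -> x < y).
  { intros x y H. destruct (Rtotal_order x y) as [L|[->|L]]; auto; [lra|apply Fi in L; lra]. }
  assert (Fs : forall x, F (x + 2 * PI) = F x + T) by (intros x; apply RInt_shift_period; auto).
  exists (fun t => G (t + F theta0)). split; [|split; [|split]].
  - apply Finj. rewrite HG1. ring.
  - intros t. evar_last.
    + apply (is_derive_comp G (fun t => t + F theta0)); [apply HG2|].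
      instantiate (1 := 1). auto_derive; auto.
    + apply Rmult_1_l.
  - intros t. apply Finj. rewrite Fs, !HG1. ring.
  - intros s Hs. split; apply Flt; rewrite ?Fs, HG1; lra.
Qed.

Lemma cos_lt_1 (d : R) : 0 < d < 2 * PI -> cos d < 1.
Proof.
  intros Hd. replace d with (2 * (d / 2)) by field. rewrite cos_2a_sin.
  assert (0 < sin (d / 2)) by (apply sin_gt_0; lra). nra.
Qed.

Section Orbit.

Variables n k : nat.
Hypothesis n_pos : (0 < n)%nat.
Hypothesis k_pos : (0 < k)%nat.

Let c := cnk n k.

Variable W : R -> R.
Hypothesis W_pos : forall x, 0 < W x.
Hypothesis W_eq : forall x, W x ^ k - c / W x ^ (2 * n + k) = x.
Hypothesis W_derive : forall x,
  is_derive W x (W x ^ S (2 * n + k) / (INR k * (W x ^ (2 * (n + k)) + 1 - c))).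

Let E x := / (W x ^ (2 * (n + k)) + 1 - c).

Lemma radius_unique (w x : R) : 0 < w -> w ^ k - c / w ^ (2 * n + k) = x -> w = W x.
Proof.
  intros Hw Hx. assert (Hc := cnk_bounds n k n_pos k_pos). fold c in Hc.
  assert (Hpl : forall j u v, 0 < u < v -> u ^ j <= v ^ j) by (intros; apply pow_incr; lra).
  assert (Hps : forall u v, 0 < u < v -> u ^ k - c / u ^ (2 * n + k) < v ^ k - c / v ^ (2 * n + k)).
  { intros u v Huv. assert (H1 := Hpl k u v Huv).
    assert (H2 : u ^ (2 * n + k) < v ^ (2 * n + k)) by (apply pow_strict_incr; [lra|lia]).
    assert (H0 : 0 < u ^ (2 * n + k)) by (apply pow_lt; lra).
    assert (H3 : / v ^ (2 * n + k) < / u ^ (2 * n + k)) by (apply Rinv_lt_contravar; nra).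
    unfold Rdiv. nra. }
  specialize (W_pos x). specialize (W_eq x).
  destruct (Rtotal_order w (W x)) as [H|[H|H]]; auto.
  - specialize (Hps w (W x) ltac:(lra)). lra.
  - specialize (Hps (W x) w ltac:(lra)). lra.
Qed.

(** On a level of the first integral the radius is a function of the angle alone, with [mu] fixing
    the size of the orbit. Only the time law is left, and [clock_exists] provides it with
    [dt/dtheta = E (h sin psi)]. *)
Lemma orbit_minimal_period (alpha phi mu theta0 : R) :
  0 < alpha -> 0 < mu ->
  let h := alpha * mu ^ (2 * n + k) in
  let r := fun theta => mu * W (h * sin (INR k * theta + phi)) in
  minimal_period (field (alpha * cos phi, alpha * sin phi) n k)
    (r theta0 * cos theta0, r theta0 * sin theta0) (mean_sin E h).
Proof.
  intros Halpha Hmu h r.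
  assert (Hc := cnk_bounds n k n_pos k_pos). fold c in Hc.
  destruct (INR_nk n k n_pos k_pos) as [Hn Hk].
  assert (Hh : 0 < h) by (apply Rmult_lt_0_compat; [|apply pow_lt]; auto).
  set (g := fun theta => E (h * sin (INR k * theta + phi))).
  assert (Ec := radius_E_continuous n k n_pos k_pos W W_pos W_derive). fold c E in Ec.
  assert (Esin : forall x, continuous (fun psi => E (h * sin psi)) x) by (apply continuous_scal_sin; exact Ec).
  assert (Hper : forall x, h * sin (INR k * (x + 2 * PI) + phi) = h * sin (INR k * x + phi)).
  { intros x. f_equal. rewrite <- (sin_period (INR k * x + phi) k). f_equal. ring. }
  destruct (clock_exists g (E h) theta0) as (HT & Theta & Th0 & Thd & Thp & Ths).
  - apply (radius_E_bounds n k n_pos k_pos W W_pos).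
  - intros x. apply (continuous_comp (fun theta => INR k * theta + phi) (fun psi => E (h * sin psi))); auto.
    apply (ex_derive_continuous (fun theta => INR k * theta + phi)). auto_derive; auto.
  (* [E] is antitone, so [E h] is its least value on [[- h, h]]. *)
  - intros x. apply (radius_E_antitone n k n_pos k_pos W W_pos W_derive).
    assert (S := SIN_bound (INR k * x + phi)). nra.
  - intros x. unfold g. rewrite Hper. reflexivity.
  - assert (HTm : RInt g 0 (2 * PI) = mean_sin E h).
    { apply (RInt_multi_angle (fun psi => E (h * sin psi))); auto.
      intros x. do 2 f_equal. rewrite <- (sin_period x 1). f_equal. simpl. ring. }
    rewrite HTm in *.
    assert (rpos : forall theta, 0 < r theta) by (intros; apply Rmult_lt_0_compat; auto).
    exists (fun t => (r (Theta t) * cos (Theta t), r (Theta t) * sin (Theta t))).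
    split; [|split; [|split; [|split]]].
    + intros t. rewrite field_polar.
      set (psi := INR k * Theta t + phi).
      assert (HW := W_pos (h * sin psi)).
      set (w := W (h * sin psi)) in *.
      set (D := w ^ (2 * (n + k)) + 1 - c).
      assert (HA : 0 < w ^ k) by (apply pow_lt; auto).
      assert (HB : 0 < w ^ (2 * n + k)) by (apply pow_lt; auto).
      assert (HAB : w ^ (2 * (n + k)) = w ^ k * w ^ (2 * n + k)) by (rewrite <- pow_add; f_equal; lia).
      assert (HD : 0 < D) by (unfold D; rewrite HAB; nra).
      assert (Hrho : alpha * r (Theta t) ^ (2 * n + k) = h * w ^ (2 * n + k)).
      { unfold r. fold psi w. rewrite Rpow_mult_distr. unfold h. ring. }
      rewrite Hrho.
      (* The defining equation of [W], multiplied by [w^m], reads [c + eta = w^(2(n+k))]; hence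
         [theta' = 1 / E], the speed of the clock. *)
      assert (Hth : 1 + h * w ^ (2 * n + k) * sin psi = D).
      { unfold D. rewrite HAB. assert (H := W_eq (h * sin psi)). fold w in H.
        replace (h * w ^ (2 * n + k) * sin psi) with (h * sin psi * w ^ (2 * n + k)) by ring.
        rewrite <- H. field. lra. }
      rewrite Hth.
      assert (Td : is_derive Theta t D).
      { assert (H := Thd t). unfold g, E in H. fold psi w D in H. rewrite Rinv_inv in H. exact H. }
      assert (rd : is_derive (fun t => r (Theta t)) t (r (Theta t) * (h * w ^ (2 * n + k) * cos psi))).
      { evar_last.
        - apply (is_derive_scal (fun t => W (h * sin (INR k * Theta t + phi)))).
          apply (is_derive_comp W (fun t => h * sin (INR k * Theta t + phi))); [apply W_derive|].
          apply (is_derive_scal (fun t => sin (INR k * Theta t + phi))).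
          apply (is_derive_comp sin (fun t => INR k * Theta t + phi)); [apply is_derive_sin|].
          apply (is_derive_plus (fun t => INR k * Theta t) (fun _ => phi)); [|apply is_derive_const].
          apply (is_derive_scal Theta), Td.
        - fold psi w D. unfold r, scal, plus, zero; cbn -[pow INR Nat.mul Nat.add]. unfold mult; cbn -[pow INR Nat.mul Nat.add].
          fold psi w. change (w ^ S (2 * n + k)) with (w * w ^ (2 * n + k)). field. lra. }
      assert (cd : is_derive (fun t => cos (Theta t)) t (D * - sin (Theta t))).
      { apply (is_derive_comp cos Theta); [apply is_derive_cos|exact Td]. }
      assert (sd : is_derive (fun t => sin (Theta t)) t (D * cos (Theta t))).
      { apply (is_derive_comp sin Theta); [apply is_derive_sin|exact Td]. }
      apply is_derive_pair.
      * evar_last.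
        -- apply (is_derive_mult (K := R_AbsRing) (fun t => r (Theta t)) (fun t => cos (Theta t))); [exact rd|exact cd|].
           intros; apply Rmult_comm.
        -- unfold plus, mult; cbn -[pow INR Nat.mul Nat.add]. ring.
      * evar_last.
        -- apply (is_derive_mult (K := R_AbsRing) (fun t => r (Theta t)) (fun t => sin (Theta t))); [exact rd|exact sd|].
           intros; apply Rmult_comm.
        -- unfold plus, mult; cbn -[pow INR Nat.mul Nat.add]. ring.
    + rewrite Th0. reflexivity.
    + exact HT.
    + intros t. rewrite Thp. unfold r. rewrite Hper.
      replace (2 * PI) with (2 * INR 1 * PI) by (simpl; ring).
      rewrite cos_period, sin_period. reflexivity.
    (* An earlier return would equate the radii and then the sines and cosines, although [Theta] has
       advanced by an amount strictly between 0 and [2 PI]. *)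
    + intros s Hs Heq. injection Heq as H1 H2.
      assert (R1 := rpos (Theta s)). assert (R2 := rpos theta0).
      assert (S1 := sin2_cos2 (Theta s)). assert (S2 := sin2_cos2 theta0). unfold Rsqr in *.
      assert (Hd := cos_lt_1 (Theta s - theta0) ltac:(specialize (Ths s Hs); lra)).
      rewrite cos_minus in Hd.
      set (u := r (Theta s)) in *. set (v := r theta0) in *.
      assert (Huv : u * u = v * v).
      { transitivity (u * cos (Theta s) * (u * cos (Theta s)) + u * sin (Theta s) * (u * sin (Theta s))).
        - transitivity (u * u * (sin (Theta s) * sin (Theta s) + cos (Theta s) * cos (Theta s))); [rewrite S1|]; ring.
        - rewrite H1, H2. transitivity (v * v * (sin theta0 * sin theta0 + cos theta0 * cos theta0)); [|rewrite S2]; ring. }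
      assert (Huv' : u = v) by nra.
      rewrite Huv' in H1, H2. apply Rmult_eq_reg_l in H1; [|lra]. apply Rmult_eq_reg_l in H2; [|lra].
      rewrite H1, H2 in Hd. lra.
Qed.

End Orbit.

(** * The period annulus *)

(** This is [xi + i eta], kept polynomial in the coordinates so that it is defined and continuous at
    the origin too. *)
Definition zpart (a : R * R) (n k : nat) (z : R * R) : R * R :=
  cmul a (cscal (znorm2 z ^ n) (cpow z k)).

Lemma field_zpart (a : R * R) (n k : nat) (z : R * R) :
  field a n k z = cmul z (cadd ci (zpart a n k z)).
Proof.
  unfold field, zpart. rewrite Nat.add_1_r. destruct a as [a1 a2]. destruct z as [x y].
  set (N := znorm2 (x, y) ^ n). change (cpow (x, y) (S k)) with (cmul (x, y) (cpow (x, y) k)).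
  destruct (cpow (x, y) k) as [P Q]. unfold cadd, cmul, cscal, ci; simpl. f_equal; ring.
Qed.

Lemma zpart_polar (alpha phi r theta : R) (n k : nat) :
  let rho := alpha * r ^ (2 * n + k) in
  let psi := INR k * theta + phi in
  zpart (alpha * cos phi, alpha * sin phi) n k (r * cos theta, r * sin theta) =
  (rho * cos psi, rho * sin psi).
Proof.
  intros rho psi. unfold zpart, znorm2. rewrite cpow_polar. unfold cmul, cscal. cbn -[pow INR Nat.mul Nat.add].
  assert (S := sin2_cos2 theta). unfold Rsqr in S.
  replace (r * cos theta * (r * cos theta) + r * sin theta * (r * sin theta)) with (r ^ 2).
  2: { transitivity (r * r * (sin theta * sin theta + cos theta * cos theta)); [rewrite S|]; ring. }
  rewrite <- pow_mult. unfold psi. rewrite cos_plus, sin_plus. unfold rho. rewrite pow_add. f_equal; ring.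
Qed.

Lemma zpart_scal (a : R * R) (n k : nat) (s : R) (z : R * R) :
  zpart a n k (cscal s z) = cscal (s ^ (2 * n + k)) (zpart a n k z).
Proof.
  assert (H : cpow (cscal s z) k = cscal (s ^ k) (cpow z k)).
  { induction k as [|j IH].
    - unfold cscal; simpl. f_equal; ring.
    - change (cpow (cscal s z) (S j)) with (cmul (cscal s z) (cpow (cscal s z) j)). rewrite IH.
      change (cpow z (S j)) with (cmul z (cpow z j)). unfold cmul, cscal; simpl. f_equal; ring. }
  unfold zpart. rewrite H.
  replace (znorm2 (cscal s z)) with (s ^ 2 * znorm2 z) by (unfold znorm2, cscal; simpl; ring).
  rewrite Rpow_mult_distr, <- pow_mult, pow_add. unfold cmul, cscal; cbn -[pow Nat.mul Nat.add]. f_equal; ring.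
Qed.

Lemma zpart_continuous (a : R * R) (n k : nat) (z : R * R) :
  continuous (fun z : R * R => snd (zpart a n k z)) z.
Proof.
  assert (Hf : forall z : R * R, continuous (fun z : R * R => fst z) z) by (intros; apply continuous_fst).
  assert (Hs : forall z : R * R, continuous (fun z : R * R => snd z) z) by (intros; apply continuous_snd).
  assert (M : forall (f g : R * R -> R), (forall z, continuous f z) -> (forall z, continuous g z) ->
    forall z, continuous (fun z => f z * g z) z) by (intros; apply (continuous_mult f g); auto).
  assert (P : forall (f g : R * R -> R), (forall z, continuous f z) -> (forall z, continuous g z) ->
    forall z, continuous (fun z => f z + g z) z) by (intros; apply (continuous_plus f g); auto).
  assert (Mi : forall (f g : R * R -> R), (forall z, continuous f z) -> (forall z, continuous g z) ->
    forall z, continuous (fun z => f z - g z) z) by (intros; apply (continuous_minus f g); auto).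
  assert (C : forall c0 : R, forall z : R * R, continuous (fun _ : R * R => c0) z) by (intros; apply continuous_const).
  assert (Hp : (forall z, continuous (fun z => fst (cpow z k)) z) /\ (forall z, continuous (fun z => snd (cpow z k)) z)).
  { induction k as [|j [IH1 IH2]].
    - simpl. split; apply C.
    - simpl. split.
      + apply Mi; apply M; auto.
      + apply P; apply M; auto. }
  assert (Hn : forall z, continuous (fun z => znorm2 z ^ n) z).
  { induction n as [|j IH]; simpl; [apply C|]. apply M; auto. apply P; apply M; auto. }
  unfold zpart, cmul, cscal; simpl. revert z. apply P; apply M; auto; apply M; tauto.
Qed.

(** The integrating factor [exp (- B)] takes the place of a uniqueness theorem: it keeps a solution
    that starts with [c + eta = 0] on that curve for all times. *)
Lemma linear_ode_zero (u b : R -> R) :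
  (forall t, continuous b t) -> (forall t, is_derive u t (b t * u t)) -> u 0 = 0 ->
  forall t, u t = 0.
Proof.
  intros Hb Hu H0 t.
  set (B := fun t : R => RInt b 0 t : R).
  assert (HB : forall t, is_derive B t (b t)) by (intros s; apply is_derive_RInt_continuous; auto).
  set (v := fun t => u t * exp (- B t)).
  assert (Hv : forall t, is_derive v t 0).
  { intros s. evar_last.
    - apply (is_derive_mult (K := R_AbsRing) u (fun t => exp (- B t))).
      + apply Hu.
      + apply (is_derive_comp exp (fun t => - B t)); [apply is_derive_exp|].
        apply (is_derive_opp B), HB.
      + intros; apply Rmult_comm.
    - change (b s * u s * exp (- B s) + u s * (- b s * exp (- B s)) = 0). ring. }
  assert (E : v t = v 0).
  { destruct (Rtotal_order t 0) as [H|[->|H]]; auto.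
    - apply (eq_is_derive v t 0); auto.
    - symmetry. apply (eq_is_derive v 0 t); auto. }
  unfold v in E. rewrite H0, Rmult_0_l in E.
  apply Rmult_integral in E. destruct E as [E|E]; auto. assert (H := exp_pos (- B t)). lra.
Qed.

(** [atan xi] would grow at rate at least [Rmin M e] for all times, yet its values lie in an
    interval of length [PI]. *)
Lemma riccati_blow_up (xi : R -> R) (M e : R) :
  0 < M -> 0 < e -> ~ (forall t, is_derive xi t (M * (xi t * xi t) + e)).
Proof.
  intros HM He H. set (d := Rmin M e). assert (Hd : 0 < d) by (apply Rmin_glb_lt; auto).
  assert (H1 : d <= M) by apply Rmin_l. assert (H2 : d <= e) by apply Rmin_r.
  assert (HPI := PI_RGT_0).
  assert (D : forall t, is_derive (fun t => atan (xi t)) t ((M * (xi t * xi t) + e) / (1 + xi t * xi t))).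
  { intros t. evar_last.
    - apply (is_derive_comp atan xi); [apply is_derive_atan|apply H].
    - unfold scal; cbn -[pow]. unfold mult; cbn -[pow]. unfold Rsqr. field. nra. }
  destruct (MVT_gen (fun t => atan (xi t)) 0 (PI / d) _ (fun x _ => D x)) as (s & _ & Hs).
  { intros x _. apply continuity_pt_filterlim. apply (is_derive_continuous_R (fun t => atan (xi t)) _ _ (D x)). }
  assert (B1 := atan_bound (xi 0)). assert (B2 := atan_bound (xi (PI / d))).
  assert (L : d <= (M * (xi s * xi s) + e) / (1 + xi s * xi s)).
  { assert (Hx : 0 <= xi s * xi s) by nra.
    apply (Rmult_le_reg_r (1 + xi s * xi s)); [lra|]. unfold Rdiv. rewrite Rmult_assoc, Rinv_l by lra. nra. }
  assert (HPd : 0 < PI / d) by (apply Rdiv_lt_0_compat; auto).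
  apply (Rmult_le_compat_r (PI / d)) in L; [|lra].
  replace (d * (PI / d)) with PI in L by (field; lra). rewrite Rminus_0_r in Hs. lra.
Qed.

Section Annulus.

Variables n k : nat.
Hypothesis n_pos : (0 < n)%nat.
Hypothesis k_pos : (0 < k)%nat.
Variable a : R * R.

Let c := cnk n k.

(** An arbitrary solution carries no continuous polar angle, so the derivative is computed in
    Cartesian coordinates, by induction on the powers. With [zeta = xi + i eta] the result is
    [zeta' = zeta (m xi + i k (1 + eta))]. *)
Lemma zpart_derive (f : R -> R * R) (t : R) :
  is_solution (field a n k) f ->
  let xi := fst (zpart a n k (f t)) in
  let eta := snd (zpart a n k (f t)) in
  is_derive (fun t => fst (zpart a n k (f t))) t
    (INR (2 * n + k) * (xi * xi) - INR k * (eta * (1 + eta))) /\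
  is_derive (fun t => snd (zpart a n k (f t))) t (2 * (INR n + INR k) * xi * (c + eta)).
Proof.
  intros Hf xi eta. destruct (INR_nk n k n_pos k_pos) as [Hn Hk].
  assert (H := Hf t). assert (Dx := is_derive_fst _ _ _ H). assert (Dy := is_derive_snd _ _ _ H).
  rewrite field_zpart in Dx, Dy. clear H.
  set (x := fun t => fst (f t)) in *. set (y := fun t => snd (f t)) in *.
  assert (Dx' : is_derive x t (x t * xi - y t * (1 + eta))).
  { evar_last; [exact Dx|]. unfold cmul, cadd, ci, x, y, xi, eta; cbn [fst snd]. ring. }
  assert (Dy' : is_derive y t (x t * (1 + eta) + y t * xi)).
  { evar_last; [exact Dy|]. unfold cmul, cadd, ci, x, y, xi, eta; cbn [fst snd]. ring. }
  clear Dx Dy.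
  assert (Exi : xi = fst a * (znorm2 (f t) ^ n * fst (cpow (f t) k)) - snd a * (znorm2 (f t) ^ n * snd (cpow (f t) k))) by reflexivity.
  assert (Eeta : eta = fst a * (znorm2 (f t) ^ n * snd (cpow (f t) k)) + snd a * (znorm2 (f t) ^ n * fst (cpow (f t) k))) by reflexivity.
  clearbody xi eta.
  assert (M : forall (g h : R -> R) dg dh, is_derive g t dg -> is_derive h t dh ->
    is_derive (fun t => g t * h t) t (dg * h t + g t * dh)).
  { intros. apply (is_derive_mult (K := R_AbsRing) g h); auto. intros; apply Rmult_comm. }
  assert (P : forall (g h : R -> R) dg dh, is_derive g t dg -> is_derive h t dh ->
    is_derive (fun t => g t + h t) t (dg + dh)) by (intros; apply (is_derive_plus g h); auto).
  assert (Mi : forall (g h : R -> R) dg dh, is_derive g t dg -> is_derive h t dh ->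
    is_derive (fun t => g t - h t) t (dg - dh)) by (intros; apply (is_derive_minus g h); auto).
  assert (C : forall c0 : R, is_derive (fun _ : R => c0) t 0)
    by (intros c0; exact (is_derive_const (K := R_AbsRing) (V := R_NormedModule) c0 t)).
  assert (Hpow : forall j,
    is_derive (fun t => fst (cpow (f t) j)) t
      (INR j * (fst (cpow (f t) j) * xi - snd (cpow (f t) j) * (1 + eta))) /\
    is_derive (fun t => snd (cpow (f t) j)) t
      (INR j * (fst (cpow (f t) j) * (1 + eta) + snd (cpow (f t) j) * xi))).
  { induction j as [|j [IH1 IH2]].
    - simpl. rewrite !Rmult_0_l. split; apply C.
    - rewrite S_INR. simpl cpow. unfold cmul; cbn -[cpow INR]. split; evar_last.
      + apply Mi; apply M; [exact Dx'|exact IH1|exact Dy'|exact IH2].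
      + unfold x, y. ring.
      + apply P; apply M; [exact Dx'|exact IH2|exact Dy'|exact IH1].
      + unfold x, y. ring. }
  assert (Hnorm : forall j, is_derive (fun t => znorm2 (f t) ^ j) t (2 * INR j * xi * znorm2 (f t) ^ j)).
  { induction j as [|j IH].
    - simpl. replace (2 * 0 * xi * 1) with 0 by ring. apply C.
    - rewrite S_INR. simpl pow. evar_last.
      + apply M; [|exact IH]. unfold znorm2. apply P; apply M; [exact Dx'|exact Dx'|exact Dy'|exact Dy'].
      + unfold znorm2, x, y. ring. }
  destruct (Hpow k) as [Pk1 Pk2]. assert (Nn := Hnorm n).
  assert (Hck : 2 * (INR n + INR k) * c = INR k) by (unfold c, cnk; field; lra).
  assert (Hm : INR (2 * n + k) = 2 * INR n + INR k) by (rewrite plus_INR, mult_INR; simpl; ring).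
  split.
  - evar_last.
    + unfold zpart, cmul, cscal. cbn -[pow cpow INR]. apply Mi; apply M.
      * apply C.
      * apply M; [exact Nn|exact Pk1].
      * apply C.
      * apply M; [exact Nn|exact Pk2].
    + rewrite Hm. cbv beta.
      transitivity ((2 * INR n + INR k) * xi * (fst a * (znorm2 (f t) ^ n * fst (cpow (f t) k)) - snd a * (znorm2 (f t) ^ n * snd (cpow (f t) k)))
        - INR k * (1 + eta) * (fst a * (znorm2 (f t) ^ n * snd (cpow (f t) k)) + snd a * (znorm2 (f t) ^ n * fst (cpow (f t) k)))); [ring|].
      rewrite <- Exi, <- Eeta. ring.
  - evar_last.
    + unfold zpart, cmul, cscal. cbn -[pow cpow INR]. apply P; apply M.
      * apply C.
      * apply M; [exact Nn|exact Pk2].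
      * apply C.
      * apply M; [exact Nn|exact Pk1].
    + cbv beta.
      transitivity ((2 * INR n + INR k) * xi * (fst a * (znorm2 (f t) ^ n * snd (cpow (f t) k)) + snd a * (znorm2 (f t) ^ n * fst (cpow (f t) k)))
        + INR k * (1 + eta) * (fst a * (znorm2 (f t) ^ n * fst (cpow (f t) k)) - snd a * (znorm2 (f t) ^ n * snd (cpow (f t) k)))); [ring|].
      rewrite <- Exi, <- Eeta.
      transitivity (INR k * xi + 2 * (INR n + INR k) * xi * eta); [ring|]. rewrite <- Hck at 1. ring.
Qed.

(** A periodic point comes with a solution defined for all times, and this is what the blow-up of
    the Riccati equation excludes. *)
Lemma boundary_not_periodic (p : R * R) :
  c + snd (zpart a n k p) = 0 -> ~ periodic_point (field a n k) p.
Proof.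
  intros Hp (T & f & Hf & H0 & _).
  destruct (INR_nk n k n_pos k_pos) as [Hn Hk]. assert (Hc := cnk_bounds n k n_pos k_pos). fold c in Hc.
  set (xi := fun t => fst (zpart a n k (f t))). set (eta := fun t => snd (zpart a n k (f t))).
  assert (Dxi : forall t, is_derive xi t (INR (2 * n + k) * (xi t * xi t) - INR k * (eta t * (1 + eta t))))
    by (intros t; apply (zpart_derive f t Hf)).
  assert (Deta : forall t, is_derive eta t (2 * (INR n + INR k) * xi t * (c + eta t)))
    by (intros t; apply (zpart_derive f t Hf)).
  assert (Heta : forall t, c + eta t = 0).
  { apply (linear_ode_zero (fun t => c + eta t) (fun t => 2 * (INR n + INR k) * xi t)).
    - intros t. apply (continuous_Rmult (fun _ => 2 * (INR n + INR k)) xi); [apply continuous_const|].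
      eapply is_derive_continuous_R, Dxi.
    - intros t. evar_last.
      + apply (is_derive_plus (fun _ => c) eta); [apply is_derive_const|apply Deta].
      + apply Rplus_0_l.
    - unfold eta. rewrite H0. exact Hp. }
  apply (riccati_blow_up xi (INR (2 * n + k)) (INR k * (c * (1 - c)))).
  - apply lt_0_INR. lia.
  - apply Rmult_lt_0_compat; [lra|]. apply Rmult_lt_0_compat; lra.
  - intros t. evar_last; [apply Dxi|]. assert (E : eta t = - c) by (specialize (Heta t); lra). rewrite E. ring.
Qed.

Lemma zpart_origin : zpart a n k origin = origin.
Proof.
  unfold zpart, origin. destruct k as [|j]; [lia|]. simpl. unfold cmul, cscal; simpl. f_equal; ring.
Qed.

(** A path from the origin, where [c + eta = c > 0], to a point with [c + eta <= 0] crosses the zero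
    set of [c + eta]. The crossing point differs from the origin and is not periodic. *)
Lemma period_annulus_inner (x : R * R) :
  period_annulus (field a n k) x -> 0 < c + snd (zpart a n k x).
Proof.
  intros (Hx & Q & _ & HQ2 & HQ0 & HQp & HQx). assert (Hc := cnk_bounds n k n_pos k_pos). fold c in Hc.
  destruct (Rlt_le_dec 0 (c + snd (zpart a n k x))) as [H|H]; auto. exfalso.
  destruct (HQ2 origin x HQ0 HQx) as (g & Hg & g0 & g1 & HgQ).
  set (h := fun t => c + snd (zpart a n k (g t))).
  destruct (IVT_gen h 0 1 0) as (t & Ht & Hht).
  - intros t. apply continuity_pt_filterlim.
    apply (continuous_plus (fun _ => c) (fun t => snd (zpart a n k (g t)))); [apply continuous_const|].
    apply (continuous_comp g (fun z => snd (zpart a n k z))); [apply Hg|apply zpart_continuous].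
  - unfold h. rewrite g0, g1, zpart_origin. change (snd origin) with 0.
    rewrite Rmin_right, Rmax_left; lra.
  - rewrite Rmin_left, Rmax_right in Ht by lra.
    apply (boundary_not_periodic (g t) Hht). apply HQp; [apply HgQ; auto|].
    intros E. unfold h in Hht. rewrite E, zpart_origin in Hht. simpl in Hht. lra.
Qed.

(** By homogeneity the new value is [c + s^m eta], a convex combination of [c] and [c + eta]. *)
Lemma annulus_star (s : R) (x : R * R) :
  0 <= s <= 1 -> 0 < c + snd (zpart a n k x) -> 0 < c + snd (zpart a n k (cscal s x)).
Proof.
  intros Hs Hx. assert (Hc := cnk_bounds n k n_pos k_pos). fold c in Hc.
  rewrite zpart_scal. unfold cscal at 1. cbn [snd].
  set (eta := snd (zpart a n k x)) in *.
  assert (H1 : 0 <= s ^ (2 * n + k)) by (apply pow_le; lra).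
  assert (H2 : s ^ (2 * n + k) <= 1) by (rewrite <- (pow1 (2 * n + k)); apply pow_incr; lra).
  destruct (Rle_lt_dec 0 eta); nra.
Qed.

Lemma annulus_path_connected :
  path_connected (fun x => 0 < c + snd (zpart a n k x)).
Proof.
  intros x y Hx Hy.
  (* With the positive part as weight, one formula, continuous on the whole line, leads from [x]
     straight to the origin and on to [y]. *)
  set (pp := fun u => (u + Rabs u) / 2).
  assert (Hpc : forall u, continuous pp u).
  { intros u. apply (continuous_Rmult (fun u => u + Rabs u) (fun _ => / 2)); [|apply continuous_const].
    apply (continuous_plus (fun u : R => u) Rabs); [apply continuous_id|apply continuous_Rabs]. }
  assert (P1 : forall u, 0 <= u -> pp u = u) by (intros u Hu; unfold pp; rewrite Rabs_pos_eq by auto; field).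
  assert (P2 : forall u, u <= 0 -> pp u = 0).
  { intros u Hu. unfold pp. rewrite Rabs_left1 by auto. field. }
  set (V := prod_NormedModule R_AbsRing R_NormedModule R_NormedModule).
  exists (fun t => cadd (cscal (pp (1 - 2 * t)) x) (cscal (pp (2 * t - 1)) y)).
  split; [|split; [|split]].
  - intros t.
    assert (L : forall (l : R -> R) (z : R * R), continuous l t -> continuous (U := V) (fun t => cscal (l t) z) t)
      by (intros l z Hl; apply (continuous_scal_l (V := V) l z); auto).
    apply (continuous_plus (V := V) (fun t => cscal (pp (1 - 2 * t)) x) (fun t => cscal (pp (2 * t - 1)) y)); apply L;
      (apply (continuous_comp _ pp); [|apply Hpc]).
    + apply (ex_derive_continuous (fun t => 1 - 2 * t)). auto_derive; auto.
    + apply (ex_derive_continuous (fun t => 2 * t - 1)). auto_derive; auto.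
  - rewrite P1, P2 by lra. destruct x, y; unfold cadd, cscal; simpl. f_equal; ring.
  - rewrite P2, P1 by lra. destruct x, y; unfold cadd, cscal; simpl. f_equal; ring.
  - intros t Ht. destruct (Rle_lt_dec t (1 / 2)) as [H|H].
    + rewrite (P1 (1 - 2 * t)), (P2 (2 * t - 1)) by lra.
      replace (cadd (cscal (1 - 2 * t) x) (cscal 0 y)) with (cscal (1 - 2 * t) x).
      * apply annulus_star; auto. lra.
      * destruct x, y; unfold cadd, cscal; simpl. f_equal; ring.
    + rewrite (P2 (1 - 2 * t)), (P1 (2 * t - 1)) by lra.
      replace (cadd (cscal 0 x) (cscal (2 * t - 1) y)) with (cscal (2 * t - 1) y).
      * apply annulus_star; auto. lra.
      * destruct x, y; unfold cadd, cscal; simpl. f_equal; ring.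
Qed.

Lemma annulus_open : open (fun x => 0 < c + snd (zpart a n k x)).
Proof.
  apply (open_comp (fun x => c + snd (zpart a n k x)) (fun y => 0 < y)).
  - intros x _. apply (continuous_plus (fun _ => c) (fun z => snd (zpart a n k z))); [apply continuous_const|].
    apply zpart_continuous.
  - apply open_gt.
Qed.

Lemma period_annulus_iff (x : R * R) :
  (forall p, p <> origin -> 0 < c + snd (zpart a n k p) -> periodic_point (field a n k) p) ->
  period_annulus (field a n k) x <-> x <> origin /\ 0 < c + snd (zpart a n k x).
Proof.
  intros Hper. split.
  - intros H. split; [apply H|apply period_annulus_inner; auto].
  - intros [Hx1 Hx2]. split; auto. exists (fun x => 0 < c + snd (zpart a n k x)).
    assert (Hc := cnk_bounds n k n_pos k_pos). fold c in Hc.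
    split; [apply annulus_open|]. split; [apply annulus_path_connected|].
    split; [rewrite zpart_origin; simpl; lra|]. split; auto.
Qed.

End Annulus.

(** * The period function along a ray *)

Definition inv_root (j : nat) (x : R) : R := Rpower x (- / INR j).

Lemma inv_root_pos (j : nat) (x : R) : 0 < inv_root j x.
Proof. apply exp_pos. Qed.

Lemma inv_root_pow (j : nat) (x : R) : (0 < j)%nat -> 0 < x -> inv_root j x ^ j = / x.
Proof.
  intros Hj Hx. assert (Hj' : 0 < INR j) by (apply lt_0_INR; auto). unfold inv_root.
  rewrite <- Rpower_pow by apply exp_pos. rewrite Rpower_mult.
  replace (- / INR j * INR j) with (- (1)) by (field; lra).
  rewrite Rpower_Ropp, Rpower_1; auto.
Qed.

Lemma pow_lt_cancel (j : nat) (u v : R) : 0 <= v -> u ^ j < v ^ j -> u < v.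
Proof.
  intros Hv H. destruct (Rlt_le_dec u v) as [L|L]; auto.
  assert (v ^ j <= u ^ j) by (apply pow_incr; lra). lra.
Qed.

Lemma inv_root_decr (j : nat) (x y : R) : (0 < j)%nat -> 0 < x < y -> inv_root j y < inv_root j x.
Proof.
  intros Hj Hxy. apply (pow_lt_cancel j); [apply Rlt_le, inv_root_pos|].
  rewrite !inv_root_pow by (auto; lra). apply Rinv_lt_contravar; nra.
Qed.

Lemma pow_le_self (j : nat) (x : R) : (0 < j)%nat -> 0 <= x <= 1 -> x ^ j <= x.
Proof.
  intros Hj Hx. destruct j as [|j]; [lia|]. simpl.
  assert (x ^ j <= 1) by (rewrite <- (pow1 j); apply pow_incr; lra). nra.
Qed.

Lemma self_le_pow (j : nat) (x : R) : (0 < j)%nat -> 1 <= x -> x <= x ^ j.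
Proof.
  intros Hj Hx. destruct j as [|j]; [lia|]. simpl.
  assert (1 <= x ^ j) by (apply pow_R1_Rle; lra). nra.
Qed.

Section Ray.

Variables n k : nat.
Hypothesis n_pos : (0 < n)%nat.
Hypothesis k_pos : (0 < k)%nat.
Variables alpha phi : R.
Hypothesis alpha_pos : 0 < alpha.

Let c := cnk n k.
Let a := (alpha * cos phi, alpha * sin phi).

Variable W : R -> R.
Hypothesis W_pos : forall x, 0 < W x.
Hypothesis W_eq : forall x, W x ^ k - c / W x ^ (2 * n + k) = x.
Hypothesis W_derive : forall x,
  is_derive W x (W x ^ S (2 * n + k) / (INR k * (W x ^ (2 * (n + k)) + 1 - c))).

Let E x := / (W x ^ (2 * (n + k)) + 1 - c).

(* The value at radius [r] of the first integral [(c + eta) / |z|^(2(n+k))],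
   where [S] is the sine of the angle [k theta + phi]. *)
Definition first_integral (S r : R) : R :=
  (c + alpha * r ^ (2 * n + k) * S) / r ^ (2 * (n + k)).

(** On the orbit of size [mu] one has [c + eta = w^(2(n+k))] and [r = mu w], so the first integral
    is [H = mu^(-2(n+k))]. Solving for [mu] gives the argument [h = alpha mu^m] of the period
    integral. *)
Definition amplitude (H : R) : R := alpha * inv_root (2 * (n + k)) H ^ (2 * n + k).

(** For the [mu] belonging to the value of the first integral, [w = r / mu] satisfies
    [w^(2(n+k)) = c + eta]. This is the equation of [W] multiplied by [w^m], so uniqueness places
    the given point on the orbit constructed from [W]. *)
Lemma orbit_period (r theta : R) :
  0 < r -> 0 < c + alpha * r ^ (2 * n + k) * sin (INR k * theta + phi) ->
  minimal_period (field a n k) (r * cos theta, r * sin theta)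
    (mean_sin E (amplitude (first_integral (sin (INR k * theta + phi)) r))).
Proof.
  intros Hr Ht. set (S := sin (INR k * theta + phi)) in *.
  set (tau := c + alpha * r ^ (2 * n + k) * S) in *.
  set (H := first_integral S r).
  assert (HN : 0 < r ^ (2 * (n + k))) by (apply pow_lt; auto).
  assert (HH : 0 < H) by (apply Rdiv_lt_0_compat; auto).
  set (mu := inv_root (2 * (n + k)) H).
  assert (Hmu : 0 < mu) by apply inv_root_pos.
  assert (HmuN : mu ^ (2 * (n + k)) = r ^ (2 * (n + k)) / tau).
  { unfold mu. rewrite inv_root_pow by (auto; lia). unfold H, first_integral. fold tau. field. lra. }
  assert (Hw : r / mu = W (amplitude H * S)).
  { apply (radius_unique n k n_pos k_pos W W_pos W_eq).
    - apply Rdiv_lt_0_compat; auto.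
    - fold c. unfold amplitude. fold mu.
      assert (Hm : 0 < mu ^ (2 * n + k)) by (apply pow_lt; auto).
      assert (Hrm : 0 < r ^ (2 * n + k)) by (apply pow_lt; auto).
      assert (Hwm : 0 < (r / mu) ^ (2 * n + k)) by (apply pow_lt, Rdiv_lt_0_compat; auto).
      apply (Rmult_eq_reg_r ((r / mu) ^ (2 * n + k))); [|lra].
      replace (((r / mu) ^ k - c / (r / mu) ^ (2 * n + k)) * (r / mu) ^ (2 * n + k))
        with ((r / mu) ^ k * (r / mu) ^ (2 * n + k) - c) by (field; lra).
      rewrite <- pow_add. replace (k + (2 * n + k))%nat with (2 * (n + k))%nat by lia.
      assert (Ed : forall j, (r / mu) ^ j = r ^ j / mu ^ j).
      { intros j. unfold Rdiv. rewrite Rpow_mult_distr, pow_inv. reflexivity. }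
      rewrite !Ed, HmuN.
      replace (r ^ (2 * (n + k)) / (r ^ (2 * (n + k)) / tau)) with tau by (field; lra).
      unfold tau. field. lra. }
  assert (J := orbit_minimal_period n k n_pos k_pos W W_pos W_eq W_derive alpha phi mu theta alpha_pos Hmu).
  simpl in J. fold c E S in J. change (alpha * mu ^ (2 * n + k)) with (amplitude H) in J.
  change (alpha * mu ^ (n + (n + 0) + k)) with (amplitude H) in J.
  rewrite <- Hw in J. replace (mu * (r / mu)) with r in J by (field; lra). exact J.
Qed.

Lemma annulus_periodic (p : R * R) :
  p <> origin -> 0 < c + snd (zpart a n k p) -> periodic_point (field a n k) p.
Proof.
  intros Hp Ht. destruct (polar_exists p Hp) as (r & theta & Hr & ->).
  unfold a in Ht. rewrite zpart_polar in Ht. eexists. apply orbit_period; auto.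
Qed.

Lemma origin_center : is_center (field a n k).
Proof.
  assert (Hc := cnk_bounds n k n_pos k_pos). fold c in Hc. split.
  - rewrite field_zpart. unfold cmul, origin; simpl. f_equal; ring.
  (* Within this radius [r^m <= r], so [|eta| <= alpha r < c / 2] and [c + eta] stays positive. *)
  - exists (Rmin 1 (c / (2 * alpha))).
    assert (H0 : 0 < c / (2 * alpha)) by (apply Rdiv_lt_0_compat; lra).
    assert (H1 := Rmin_l 1 (c / (2 * alpha))). assert (H2 := Rmin_r 1 (c / (2 * alpha))).
    assert (H3 : 0 < Rmin 1 (c / (2 * alpha))) by (apply Rmin_glb_lt; lra).
    set (r0 := Rmin 1 (c / (2 * alpha))) in *.
    split; auto. intros p Hp.
    assert (Hp0 : p <> origin).
    { intros ->. unfold znorm2, origin in Hp; simpl in Hp. lra. }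
    apply annulus_periodic; auto.
    destruct (polar_exists p Hp0) as (r & theta & Hr & ->).
    unfold a. rewrite zpart_polar. cbn [snd].
    assert (Hrr : r * r < r0 * r0).
    { assert (S := sin2_cos2 theta). unfold Rsqr in S. unfold znorm2 in Hp. cbn [fst snd] in Hp.
      replace (r * r) with (r * cos theta * (r * cos theta) + r * sin theta * (r * sin theta)); [lra|].
      transitivity (r * r * (sin theta * sin theta + cos theta * cos theta)); [ring|rewrite S; ring]. }
    assert (Hrr0 : r < r0) by nra.
    assert (Hm : r ^ (2 * n + k) <= r) by (apply pow_le_self; [lia|lra]).
    assert (Hm0 : 0 < r ^ (2 * n + k)) by (apply pow_lt; auto).
    assert (S := SIN_bound (INR k * theta + phi)).
    assert (A1 : alpha * r < c / 2).
    { apply Rlt_le_trans with (alpha * (c / (2 * alpha))); [apply Rmult_lt_compat_l; lra|right; field; lra]. }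
    assert (A2 : alpha * r ^ (2 * n + k) <= alpha * r) by (apply Rmult_le_compat_l; lra).
    assert (A3 : 0 < alpha * r ^ (2 * n + k)) by (apply Rmult_lt_0_compat; lra).
    nra.
Qed.

Variable theta : R.
Let u := (cos theta, sin theta).
Let S := sin (INR k * theta + phi).

(** Along the ray [c + eta] is monotone in [s] and starts at [c > 0], so its sign at the end point
    decides for the whole segment. *)
Lemma ray_section_iff (s : R) :
  ray_section (field a n k) u s <-> 0 < s /\ 0 < c + alpha * s ^ (2 * n + k) * S.
Proof.
  assert (Hc := cnk_bounds n k n_pos k_pos). fold c in Hc.
  assert (Hval : forall s', snd (zpart a n k (ray_point u s')) = alpha * s' ^ (2 * n + k) * S).
  { intros s'. unfold a, ray_point, u, cscal. cbn [fst snd]. rewrite zpart_polar. reflexivity. }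
  assert (Hiff : forall x, period_annulus (field a n k) x <-> x <> origin /\ 0 < c + snd (zpart a n k x)).
  { intros x. apply period_annulus_iff; auto. apply annulus_periodic. }
  split.
  - intros [Hs H]. split; auto. specialize (H s ltac:(lra)). apply Hiff in H. rewrite Hval in H. tauto.
  - intros [Hs H]. split; auto. intros s' Hs'. apply Hiff. rewrite Hval. split.
    + intros E0. unfold ray_point, u, cscal, origin in E0. cbn [fst snd] in E0. injection E0 as E1 E2.
      assert (P := sin2_cos2 theta). unfold Rsqr in P.
      apply Rmult_integral in E1. apply Rmult_integral in E2.
      destruct E1 as [E1|E1]; [lra|]. destruct E2 as [E2|E2]; [lra|]. rewrite E1, E2 in P. lra.
    + assert (0 < s' ^ (2 * n + k)) by (apply pow_lt; lra).
      assert (s' ^ (2 * n + k) <= s ^ (2 * n + k)) by (apply pow_incr; lra).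
      destruct (Rle_lt_dec 0 S) as [HS|HS].
      * assert (0 <= alpha * s' ^ (2 * n + k) * S); [|lra].
        apply Rmult_le_pos; [apply Rmult_le_pos|]; lra.
      * assert (0 <= alpha * (s ^ (2 * n + k) - s' ^ (2 * n + k)) * - S); [|lra].
        apply Rmult_le_pos; [apply Rmult_le_pos|]; lra.
Qed.

(** In the variable [1 / s] this is a polynomial, defined at 0 as well, and a product of increasing
    factors that are positive inside the annulus. The first fact gives all its positive values, the
    second its monotonicity. *)
Lemma first_integral_inv (s : R) :
  0 < s -> first_integral S s = (/ s) ^ k * (c * (/ s) ^ (2 * n + k) + alpha * S).
Proof.
  intros Hs. unfold first_integral. rewrite !pow_inv.
  replace (2 * (n + k))%nat with (k + (2 * n + k))%nat by lia. rewrite (pow_add s k).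
  assert (0 < s ^ k) by (apply pow_lt; auto). assert (0 < s ^ (2 * n + k)) by (apply pow_lt; auto).
  field. lra.
Qed.

Lemma ray_factor_pos (s : R) :
  0 < s -> 0 < c + alpha * s ^ (2 * n + k) * S -> 0 < c * (/ s) ^ (2 * n + k) + alpha * S.
Proof.
  intros Hs H. assert (Hp : 0 < s ^ (2 * n + k)) by (apply pow_lt; auto). rewrite pow_inv.
  replace (c * / s ^ (2 * n + k) + alpha * S) with ((c + alpha * s ^ (2 * n + k) * S) / s ^ (2 * n + k)) by (field; lra).
  apply Rdiv_lt_0_compat; auto.
Qed.

Lemma first_integral_decr (s1 s2 : R) :
  0 < s1 < s2 -> 0 < c + alpha * s2 ^ (2 * n + k) * S ->
  0 < first_integral S s2 < first_integral S s1.
Proof.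
  intros Hs H. assert (Hc := cnk_bounds n k n_pos k_pos). fold c in Hc.
  assert (F := ray_factor_pos s2 ltac:(lra) H).
  rewrite !first_integral_inv by lra.
  assert (Hv : 0 < / s2 < / s1) by (split; [apply Rinv_0_lt_compat; lra|apply Rinv_lt_contravar; nra]).
  assert (P1 : (/ s2) ^ k < (/ s1) ^ k) by (apply pow_strict_incr; [lra|auto]).
  assert (P2 : (/ s2) ^ (2 * n + k) < (/ s1) ^ (2 * n + k)) by (apply pow_strict_incr; [lra|lia]).
  assert (P3 : 0 < (/ s2) ^ k) by (apply pow_lt; lra).
  split; [apply Rmult_lt_0_compat; auto|]. apply Rmult_gt_0_lt_compat; auto; nra.
Qed.

Lemma amplitude_decr (H1 H2 : R) : 0 < H1 < H2 -> 0 < amplitude H2 < amplitude H1.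
Proof.
  intros H. unfold amplitude.
  assert (P := inv_root_pos (2 * (n + k)) H2).
  split; [apply Rmult_lt_0_compat; auto; apply pow_lt; auto|].
  apply Rmult_lt_compat_l; auto. apply pow_strict_incr; [|lia].
  split; [lra|]. apply inv_root_decr; auto. lia.
Qed.

Lemma amplitude_small (h0 : R) :
  0 < h0 -> exists H0, 0 < H0 /\ forall H, H0 < H -> 0 < amplitude H < h0.
Proof.
  intros Hh. set (mu0 := Rmin 1 (h0 / alpha)).
  assert (Hq : 0 < h0 / alpha) by (apply Rdiv_lt_0_compat; auto).
  assert (Hmu : 0 < mu0) by (apply Rmin_glb_lt; lra).
  assert (HP : 0 < mu0 ^ (2 * (n + k))) by (apply pow_lt; auto).
  exists (/ mu0 ^ (2 * (n + k))). split; [apply Rinv_0_lt_compat; auto|]. intros H HH.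
  assert (H0 : 0 < / mu0 ^ (2 * (n + k))) by (apply Rinv_0_lt_compat; auto).
  assert (Hpos := inv_root_pos (2 * (n + k)) H).
  assert (L : inv_root (2 * (n + k)) H < mu0).
  { apply (pow_lt_cancel (2 * (n + k))); [lra|]. rewrite inv_root_pow by (lia || lra).
    rewrite <- (Rinv_inv (mu0 ^ (2 * (n + k)))). apply Rinv_lt_contravar; nra. }
  unfold amplitude. split; [apply Rmult_lt_0_compat; auto; apply pow_lt; auto|].
  assert (L1 : mu0 <= 1) by apply Rmin_l. assert (L2 : mu0 <= h0 / alpha) by apply Rmin_r.
  apply Rle_lt_trans with (alpha * inv_root (2 * (n + k)) H).
  - apply Rmult_le_compat_l; [lra|]. apply pow_le_self; [lia|lra].
  - apply Rlt_le_trans with (alpha * (h0 / alpha)); [apply Rmult_lt_compat_l; lra|right; field; lra].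
Qed.

Lemma amplitude_large (h0 : R) :
  0 < h0 -> exists H0, 0 < H0 /\ forall H, 0 < H <= H0 -> h0 <= amplitude H.
Proof.
  intros Hh. set (mu0 := Rmax 1 (h0 / alpha)).
  assert (L1 : 1 <= mu0) by apply Rmax_l. assert (L2 : h0 / alpha <= mu0) by apply Rmax_r.
  assert (HP : 0 < mu0 ^ (2 * (n + k))) by (apply pow_lt; lra).
  exists (/ mu0 ^ (2 * (n + k))). split; [apply Rinv_0_lt_compat; auto|]. intros H HH.
  assert (L : mu0 <= inv_root (2 * (n + k)) H).
  { destruct (Rle_lt_dec mu0 (inv_root (2 * (n + k)) H)) as [L|L]; auto. exfalso.
    assert (P := pow_strict_incr (2 * (n + k)) _ _ (conj (Rlt_le _ _ (inv_root_pos (2 * (n + k)) H)) L) ltac:(lia)).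
    rewrite inv_root_pow in P by (lia || lra).
    apply Rinv_lt_contravar in P; [rewrite Rinv_inv in P; lra|].
    apply Rmult_lt_0_compat; auto. apply Rinv_0_lt_compat; lra. }
  unfold amplitude. apply Rle_trans with (alpha * inv_root (2 * (n + k)) H).
  - apply Rle_trans with (alpha * (h0 / alpha)); [right; field; lra|apply Rmult_le_compat_l; lra].
  - apply Rmult_le_compat_l; [lra|]. apply self_le_pow; [lia|lra].
Qed.

Lemma first_integral_large (H0 : R) :
  0 < H0 -> exists delta, 0 < delta /\ forall s, 0 < s < delta -> H0 < first_integral S s.
Proof.
  intros HH. assert (Hc := cnk_bounds n k n_pos k_pos). fold c in Hc.
  (* The bound 1 makes powers of [s] at most [s]; the second bound keeps [c + eta] above [c / 2],
     the third keeps [H0 s^(2(n+k))] below it. *)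
  set (delta := Rmin (Rmin 1 (c / (2 * alpha))) (c / (2 * H0))).
  exists delta.
  assert (D1 : delta <= 1) by (apply Rle_trans with (1 := Rmin_l _ _), Rmin_l).
  assert (D2 : delta <= c / (2 * alpha)) by (apply Rle_trans with (1 := Rmin_l _ _), Rmin_r).
  assert (D3 : delta <= c / (2 * H0)) by apply Rmin_r.
  split.
  { repeat apply Rmin_glb_lt; try lra; apply Rdiv_lt_0_compat; lra. }
  intros s Hs. unfold first_integral.
  assert (Hm : s ^ (2 * n + k) <= s) by (apply pow_le_self; [lia|lra]).
  assert (Hm0 : 0 < s ^ (2 * n + k)) by (apply pow_lt; lra).
  assert (HN : s ^ (2 * (n + k)) <= s) by (apply pow_le_self; [lia|lra]).
  assert (HN0 : 0 < s ^ (2 * (n + k))) by (apply pow_lt; lra).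
  assert (B := SIN_bound (INR k * theta + phi)). fold S in B.
  assert (A1 : alpha * s < c / 2).
  { apply Rlt_le_trans with (alpha * (c / (2 * alpha))); [apply Rmult_lt_compat_l; lra|right; field; lra]. }
  assert (A2 : alpha * s ^ (2 * n + k) <= alpha * s) by (apply Rmult_le_compat_l; lra).
  assert (A3 : 0 < alpha * s ^ (2 * n + k)) by (apply Rmult_lt_0_compat; lra).
  assert (A4 : H0 * s < c / 2).
  { apply Rlt_le_trans with (H0 * (c / (2 * H0))); [apply Rmult_lt_compat_l; lra|right; field; lra]. }
  assert (A5 : H0 * s ^ (2 * (n + k)) <= H0 * s) by (apply Rmult_le_compat_l; lra).
  apply (Rmult_lt_reg_r (s ^ (2 * (n + k)))); auto.
  unfold Rdiv. rewrite Rmult_assoc, Rinv_l by lra. nra.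
Qed.

(** A ray with [S < 0] meets the boundary at finite distance, any other ray runs to infinity.
    Prescribing a small value of the first integral yields the radius [s0] of the outer limit in
    both cases. *)
Lemma first_integral_attains (H0 : R) :
  0 < H0 -> exists s, 0 < s /\ 0 < c + alpha * s ^ (2 * n + k) * S /\ first_integral S s = H0.
Proof.
  intros HH. assert (Hc := cnk_bounds n k n_pos k_pos). fold c in Hc.
  set (F := fun v => v ^ k * (c * v ^ (2 * n + k) + alpha * S)).
  (* [c V = c + alpha + H0] keeps the second factor of [F V] above [H0] even for [S = - 1], and the
     first factor is at least 1. *)
  set (V := 1 + (alpha + H0) / c).
  assert (HV : 1 <= V).
  { assert (0 < (alpha + H0) / c) by (apply Rdiv_lt_0_compat; lra). unfold V. lra. }
  assert (F0 : F 0 = 0) by (unfold F; rewrite pow_i by auto; ring).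
  assert (B := SIN_bound (INR k * theta + phi)). fold S in B.
  assert (FV : H0 <= F V).
  { unfold F. assert (V1 : 1 <= V ^ k) by (apply pow_R1_Rle; auto).
    assert (V2 : V <= V ^ (2 * n + k)) by (apply self_le_pow; [lia|auto]).
    assert (cV : c * V = c + alpha + H0) by (unfold V; field; lra).
    assert (c * V <= c * V ^ (2 * n + k)) by (apply Rmult_le_compat_l; lra).
    assert (H0 <= c * V ^ (2 * n + k) + alpha * S) by nra. nra. }
  destruct (IVT_gen F 0 V H0) as (v & Hv & HFv).
  - intros v. apply continuity_pt_filterlim. apply (ex_derive_continuous F). unfold F. auto_derive. auto.
  - rewrite F0, Rmin_left, Rmax_right; lra.
  - rewrite Rmin_left, Rmax_right in Hv by lra.
    assert (Hv0 : 0 < v) by (destruct Hv as [[L|<-] _]; [auto|lra]).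
    assert (Hs : 0 < / v) by (apply Rinv_0_lt_compat; auto).
    exists (/ v). split; auto. split.
    + assert (P : 0 < v ^ k) by (apply pow_lt; auto). assert (Q : 0 < v ^ (2 * n + k)) by (apply pow_lt; auto).
      assert (0 < c * v ^ (2 * n + k) + alpha * S) by (unfold F in HFv; nra).
      rewrite pow_inv. replace (c + alpha * / v ^ (2 * n + k) * S)
        with ((c * v ^ (2 * n + k) + alpha * S) / v ^ (2 * n + k)) by (field; lra).
      apply Rdiv_lt_0_compat; auto.
    + rewrite first_integral_inv, Rinv_inv by auto. exact HFv.
Qed.

(** As [s] grows, the first integral decreases, the amplitude increases and the mean decreases; both
    limits are carried along the same chain. *)
Lemma ray_period_function :
  exists Tp : R -> R,
    (forall s, ray_section (field a n k) u s ->
       minimal_period (field a n k) (ray_point u s) (Tp s)) /\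
    (forall s1 s2, ray_section (field a n k) u s1 ->
       ray_section (field a n k) u s2 -> s1 < s2 -> Tp s2 < Tp s1) /\
    (forall eps, 0 < eps -> exists delta, 0 < delta /\
       forall s, ray_section (field a n k) u s -> s < delta ->
         Rabs (Tp s - 2 * PI) < eps) /\
    (forall eps, 0 < eps -> exists s0, ray_section (field a n k) u s0 /\
       forall s, ray_section (field a n k) u s -> s0 <= s ->
         Rabs (Tp s - 2 * (INR k + INR n) * PI / (INR k + 2 * INR n)) < eps).
Proof.
  destruct (INR_nk n k n_pos k_pos) as [Hn Hk].
  exists (fun s => mean_sin E (amplitude (first_integral S s))). split; [|split; [|split]].
  - intros s Hs. apply ray_section_iff in Hs. destruct Hs as [Hs1 Hs2]. apply orbit_period; auto.
  - intros s1 s2 Hs1 Hs2 Hlt. apply ray_section_iff in Hs1. apply ray_section_iff in Hs2.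
    apply (radius_mean_decreasing n k n_pos k_pos W W_pos W_eq W_derive).
    apply amplitude_decr, first_integral_decr; [lra|tauto].
  - intros eps He.
    destruct (radius_mean_lim_0 n k n_pos k_pos W W_pos W_eq W_derive eps He) as (h0 & Hh0 & Hlim).
    destruct (amplitude_small h0 Hh0) as (H0 & HH0 & Hamp).
    destruct (first_integral_large H0 HH0) as (delta & Hd & Hfi).
    exists delta. split; auto. intros s Hs Hsd. apply ray_section_iff in Hs.
    apply Hlim, Hamp, Hfi. lra.
  - intros eps He.
    destruct (radius_mean_lim_infty n k n_pos k_pos W W_pos W_eq W_derive eps He) as (h0 & Hh0 & Hlim).
    destruct (amplitude_large h0 Hh0) as (H0 & HH0 & Hamp).
    destruct (first_integral_attains H0 HH0) as (s0 & Hs0 & Ht0 & Hfi).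
    exists s0. split; [apply ray_section_iff; auto|].
    intros s Hs Hle. apply ray_section_iff in Hs.
    (* Indeed [1 - c = (k + 2n) / (2 (k + n))]. *)
    replace (2 * (INR k + INR n) * PI / (INR k + 2 * INR n)) with (PI * / (1 - c)).
    2: { unfold c, cnk. field. lra. }
    apply Hlim, Hamp. rewrite <- Hfi. destruct Hle as [Hlt|<-].
    + destruct (first_integral_decr s0 s); [lra|tauto|]. lra.
    + lra.
Qed.

End Ray.

Theorem theoremA (n k : nat) (a : R * R) :
  (0 < n)%nat -> (0 < k)%nat -> a <> (0, 0) ->
  is_center (field a n k) /\
  forall u : R * R,
    fst u * fst u + snd u * snd u = 1 ->
    transversal_ray (field a n k) u ->
    exists Tp : R -> R,
      (forall s, ray_section (field a n k) u s ->
         minimal_period (field a n k) (ray_point u s) (Tp s)) /\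
      (* monotonous decreasing period function *)
      (forall s1 s2, ray_section (field a n k) u s1 ->
         ray_section (field a n k) u s2 -> s1 < s2 -> Tp s2 < Tp s1) /\
      (* limit 2*pi at the center *)
      (forall eps, 0 < eps -> exists delta, 0 < delta /\
         forall s, ray_section (field a n k) u s -> s < delta ->
           Rabs (Tp s - 2 * PI) < eps) /\
      (* limit 2(k+n)pi/(k+2n) at the outer boundary of the period annulus *)
      (forall eps, 0 < eps -> exists s0, ray_section (field a n k) u s0 /\
         forall s, ray_section (field a n k) u s -> s0 <= s ->
           Rabs (Tp s - 2 * (INR k + INR n) * PI / (INR k + 2 * INR n)) < eps).
Proof.
  intros n_pos k_pos Ha.
  destruct (polar_exists a Ha) as (alpha & phi & Halpha & ->).
  destruct (radius_exists n k n_pos k_pos) as (W & W_pos & W_eq & W_derive).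
  split; [apply (origin_center n k n_pos k_pos alpha phi Halpha W); auto|].
  intros u Hu _.
  assert (Hu0 : u <> (0, 0)) by (intros ->; simpl in Hu; lra).
  destruct (polar_exists u Hu0) as (r & theta & Hr & ->).
  assert (r1 : r = 1).
  { cbn [fst snd] in Hu. assert (S := sin2_cos2 theta). unfold Rsqr in S.
    assert (r * r = 1); [|nra].
    rewrite <- Hu. transitivity (r * r * (sin theta * sin theta + cos theta * cos theta)); [rewrite S|]; ring. }
  rewrite r1, !Rmult_1_l.
  apply (ray_period_function n k n_pos k_pos alpha phi Halpha W); auto.
Qed.
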